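(* Let $d\ge2$ and let $\varphi^\varepsilon$, $\omega$, $D_1$, $\epsilon_1$ be as in the context. There exists $c_4=c_4(\omega,D_1)>0$ such that $$\int_0^T\int_\Omega\varepsilon\Big(\Delta\varphi^\varepsilon-\frac{W'(\varphi^\varepsilon)}{\varepsilon^2}\Big)^2\,dx\,dt\le c_4(1+T)$$ for every $T>0$ and every $\varepsilon\in(0,\epsilon_1)$.
   Context: Basic notation. $\Omega=\mathbb{T}^d=(\mathbb{R}/\mathbb{Z})^d$, also identified with $[0,1)^d\subset\mathbb{R}^d$; functions, sets and measures on $\Omega$ are extended $\Omega$-periodically to $\mathbb{R}^d$. $W(s)=\frac{(1-s^2)^2}{2}$, $k(s)=\int_0^s\sqrt{2W(\tau)}\,d\tau$ (equal to $s-\frac13s^3$ for $|s|\le1$), $\sigma=\int_{-1}^1\sqrt{2W(s)}\,ds$, $q^\varepsilon(r)=\tanh(r/\varepsilon)$. $B_R(x)$ is the open ball, $\omega_{d-1}$ the volume of the unit ball of $\mathbb{R}^{d-1}$; $\|\nabla\chi_A\|$ is the total variation measure of the distributional gradient of $\chi_A$. Initial set. $U_0\subset\subset(0,1)^d$ is a bounded open set, $M_0=\partial U_0$, such that: (1) there is $D_0>0$ with $\sup_{x\in\mathbb{R}^d,R>0}\frac{\mathcal{H}^{d-1}(M_0\cap B_R(x))}{\omega_{d-1}R^{d-1}}\le D_0$; (2) there are open sets $U_0^i\subset(0,1)^d$, $i\ge1$, with $C^3$ boundaries $M_0^i$, such that $\mathcal{L}^d(U_0\triangle U_0^i)\to0$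 and $\|\nabla\chi_{U_0^i}\|\to\|\nabla\chi_{U_0}\|$ as measures. $U_0^i$, $M_0^i$ are extended periodically to $\mathbb{R}^d$. Initial data. Let $\varepsilon_i\in(0,1)$, $\varepsilon_i\downarrow0$. Let $r_{\varepsilon_i}(x)=\mathrm{dist}(x,M_0^i)$ for $x\in U_0^i$ and $-\mathrm{dist}(x,M_0^i)$ for $x\notin U_0^i$; let $\overline{r_{\varepsilon_i}}$ be a periodic smoothing of $r_{\varepsilon_i}$ with $|\nabla\overline{r_{\varepsilon_i}}|\le1$, $|\nabla^2\overline{r_{\varepsilon_i}}|\le\varepsilon_i^{-1}$ on $\mathbb{R}^d$ and $\overline{r_{\varepsilon_i}}=r_{\varepsilon_i}$ near $M_0^i$. Put $\varphi_0^{\varepsilon_i}=q^{\varepsilon_i}(\overline{r_{\varepsilon_i}})$. Throughout, $\varepsilon$ stands for elements $\varepsilon_i$ of this sequence (so $\varepsilon\in(0,\epsilon_1)$ means those $\varepsilon_i<\epsilon_1$). Equation. $\varphi^\varepsilon$ is the (periodic, global in time) solution of $$\varepsilon\varphi_t^\varepsilon=\varepsilon\Delta\varphi^\varepsilon-\frac{W'(\varphi^\varepsilon)}{\varepsilon}+\lambda^\varepsilon\sqrt{2W(\varphi^\varepsilon)}\ \text{ in }\Omega\times(0,\infty),\qquad\varphi^\varepsilon(\cdot,0)=\varphi_0^\varepsilon,$$ $$\lambda^\varepsilon(t)=\frac{-\int_\Omega\sqrt{2W(\varphi^\varepsilon)}\,\big(\varepsilon\Delta\varphi^\varepsilon-W'(\varphi^\varepsilon)/\varepsilon\big)\,dx}{2\int_\Omega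 W(\varphi^\varepsilon)\,dx}.$$ Measures and constants. $\mu_t^\varepsilon(\phi)=\frac1\sigma\int_{\mathbb{R}^d}\phi\big(\frac{\varepsilon|\nabla\varphi^\varepsilon|^2}{2}+\frac{W(\varphi^\varepsilon)}{\varepsilon}\big)dx$ for $\phi\in C_c(\mathbb{R}^d)$. Standing properties of the initial data: $\omega=\omega(U_0)>0$ and $D_1=D_1(D_0)>0$ are constants such that, for all $\varepsilon=\varepsilon_i$, $|\int_\Omega k(\varphi_0^\varepsilon)\,dx|\le\frac23-\omega$, $\mu_0^\varepsilon(\Omega)\le D_1$, and $\mu_0^\varepsilon(B_R(x))\le D_1\omega_{d-1}R^{d-1}$ for all $x\in\mathbb{R}^d$, $0<R\le1$. The constants $c_1=c_1(\omega,D_1)>0$ and $\epsilon_1=\epsilon_1(\omega)>0$ are such that $\sup_{\varepsilon\in(0,\epsilon_1)}\int_0^T|\lambda^\varepsilon(t)|^2\,dt\le c_1(1+T)$ for every $T>0$. *)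

(* Defs.v *)
From HB Require Import structures.
From mathcomp Require Import all_boot all_order all_algebra.
From mathcomp Require Import all_classical all_reals all_analysis.

Set Implicit Arguments.
Unset Strict Implicit.
Unset Printing Implicit Defensive.
Import Order.TTheory GRing.Theory Num.Theory.
Import numFieldNormedType.Exports.
Local Open Scope classical_set_scope.
Local Open Scope ring_scope.

(* R^n is 'rV[R]_n.  The library norm `|x| on 'rV[R]_n is the sup norm: it
   gives the topology, but balls, gradients and diameters below are measured
   with the Euclidean norm enorm. *)

Section lebesgue_measure_rV.
Context {R : realType}.

Definition rV_display : measure_display. Proof. exact. Qed.

Section measurable_rV.
Variable n : nat.

Definition rV_coord (i : 'I_n) (x : 'rV[R]_n) : measurableTypeR R := x ord0 i.

Let rV_set0 : g_sigma_preimage rV_coord set0.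
Proof. exact: sigma_algebra0. Qed.

Let rV_setC A : g_sigma_preimage rV_coord A -> g_sigma_preimage rV_coord (~` A).
Proof. exact: sigma_algebraC. Qed.

Let rV_bigcup (F : (set 'rV[R]_n)^nat) :
  (forall i, g_sigma_preimage rV_coord (F i)) ->
  g_sigma_preimage rV_coord (\bigcup_i (F i)).
Proof. exact: sigma_algebra_bigcup. Qed.

(* The sigma-algebra generated by the coordinates, i.e. the Borel one. *)
HB.instance Definition _ := @isMeasurable.Build rV_display
  'rV[R]_n (g_sigma_preimage rV_coord) rV_set0 rV_setC rV_bigcup.

Lemma measurable_rV_coord (i : 'I_n) :
  measurable_fun [set: 'rV[R]_n] (rV_coord i).
Proof.
move=> _ Y mY; rewrite setTI; apply: sub_sigma_algebra => /=.
rewrite -bigcup_seq/=; exists i => /=; first by rewrite mem_index_enum.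
by exists Y => //; rewrite setTI.
Qed.

Lemma measurable_fun_rVP d (T : measurableType d) (f : T -> 'rV[R]_n) :
  (forall i, measurable_fun [set: T] (rV_coord i \o f)) ->
  measurable_fun [set: T] f.
Proof.
move=> mf.
have sub : g_sigma_preimage (fun i => rV_coord i \o f) `<=` measurable.
  apply: smallest_sub; first exact: sigma_algebra_measurable.
  rewrite -bigcup_seq; apply: bigcup_sub => i _ A [B mB <-]; exact: mf.
move=> _ A mA; apply: sub; rewrite g_sigma_preimage_comp.
by exists A => //; rewrite setTI.
Qed.

End measurable_rV.

Definition rV_cons n (p : measurableTypeR R * 'rV[R]_n) : 'rV[R]_n.+1 :=
  row_mx (const_mx p.1 : 'rV[R]_1) p.2.

Definition rV_uncons n (x : 'rV[R]_n.+1) : measurableTypeR R * 'rV[R]_n :=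
  ((x : 'rV[R]_(1 + n)) ord0 (lshift n ord0), rsubmx (x : 'rV[R]_(1 + n))).

Lemma rV_consK n : cancel (@rV_cons n) (@rV_uncons n).
Proof.
rewrite /cancel => -[a x]; rewrite /rV_uncons /rV_cons/= row_mxKr; congr pair.
by rewrite row_mxEl mxE.
Qed.

Lemma measurable_rV_cons n : measurable_fun setT (@rV_cons n).
Proof.
apply: measurable_fun_rVP => i; rewrite -(@splitK 1 n i).
case: (@fintype.split 1 n i) => j /=.
  rewrite (_ : _ \o _ = fst); first exact: measurable_fst.
  by apply/funext => p; rewrite /rV_coord/= /rV_cons (@row_mxEl _ 1 1 n) mxE.
rewrite (_ : _ \o _ = rV_coord j \o snd).
  exact: measurableT_comp (measurable_rV_coord j) measurable_snd.
by apply/funext => p; rewrite /rV_coord/= /rV_cons (@row_mxEr _ 1 1 n).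
Qed.

Lemma measurable_rV_uncons n : measurable_fun setT (@rV_uncons n).
Proof.
apply/measurable_fun_pairP; split => /=.
  exact: (measurable_rV_coord (lshift n ord0 : 'I_(1 + n))).
apply: measurable_fun_rVP => i.
rewrite (_ : _ \o _ = rV_coord (rshift 1 i : 'I_(1 + n))).
  exact: measurable_rV_coord.
by apply/funext => x; rewrite /rV_coord/= mxE.
Qed.

Section leb_step.
Variables (n : nat) (m : {sigma_finite_measure set 'rV[R]_n -> \bar R}).

Definition leb_step : set 'rV[R]_n.+1 -> \bar R :=
  pushforward (lebesgue_measure \x m)%E (@rV_cons n).

Let leb_step0 : leb_step set0 = 0%E.
Proof. by rewrite /leb_step /pushforward preimage_set0 measure0. Qed.

Let leb_step_ge0 A : (0 <= leb_step A)%E.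
Proof. by rewrite /leb_step /pushforward; exact: measure_ge0. Qed.

Let measurable_pre (A : set 'rV[R]_n.+1) :
  measurable A -> measurable (@rV_cons n @^-1` A).
Proof. by move=> mA; rewrite -[X in measurable X]setTI; exact: measurable_rV_cons. Qed.

Let leb_step_sigma_additive : semi_sigma_additive leb_step.
Proof.
move=> F mF tF mUF; rewrite /leb_step /pushforward preimage_bigcup.
apply: measure_semi_sigma_additive.
- by move=> i; exact: measurable_pre.
- apply/trivIsetP => /= i j _ _ ij; rewrite -preimage_setI.
  by move/trivIsetP : tF => /(_ _ _ _ _ ij) ->//; rewrite preimage_set0.
- by rewrite -preimage_bigcup; exact: measurable_pre.
Qed.

HB.instance Definition _ := isMeasure.Build _ _ _ leb_step
  leb_step0 leb_step_ge0 leb_step_sigma_additive.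

Let leb_step_sigma_finite : sigma_finite setT leb_step.
Proof.
have /sigma_finiteP[F [TF ndF Foo]] := sigma_finiteT (@lebesgue_measure R).
have /sigma_finiteP[G [TG ndG Goo]] := sigma_finiteT m.
exists (fun i => @rV_uncons n @^-1` (F i `*` G i)).
  rewrite -preimage_bigcup; apply/seteqP; split => // x _.
  have [k _ Fk] : (\bigcup_i F i) (rV_uncons x).1 by rewrite -TF.
  have [l _ Gl] : (\bigcup_i G i) (rV_uncons x).2 by rewrite -TG.
  exists (maxn k l) => //; split.
    by have /subsetPset := ndF _ _ (leq_maxl k l); exact.
  by have /subsetPset := ndG _ _ (leq_maxr k l); exact.
move=> i; have [mF oF] := Foo i; have [mG oG] := Goo i; split.
  rewrite -[X in measurable X]setTI; apply: measurable_rV_uncons => //.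
  exact: measurableX.
rewrite /leb_step /pushforward -comp_preimage.
rewrite (_ : @rV_uncons n \o @rV_cons n = id); last first.
  by apply/funext => p; exact: rV_consK.
by rewrite preimage_id product_measure1E// lte_mul_pinfty// ge0_fin_numE.
Qed.

HB.instance Definition _ := Measure_isSigmaFinite.Build _ _ _ leb_step
  leb_step_sigma_finite.

End leb_step.

(* n-dimensional Lebesgue measure: the n-fold product of the one-dimensional
   one, transported to row vectors; in dimension 0 the unit mass at the point. *)
Fixpoint leb n : {sigma_finite_measure set 'rV[R]_n -> \bar R} :=
  match n with
  | 0 => \d_(0 : 'rV[R]_0)
  | n'.+1 => leb_step (leb n')
  end.

End lebesgue_measure_rV.

Section euclidean.
Context {R : realType} {n : nat}.
Implicit Types (x y : 'rV[R]_n) (A U V : set 'rV[R]_n) (f : 'rV[R]_n -> R).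

Definition enorm x : R := Num.sqrt (\sum_i x ord0 i ^+ 2).

Definition eball x (r : R) : set 'rV[R]_n := [set y | enorm (y - x) < r].

(* Only used when A is nonempty: inf set0 = 0. *)
Definition dist_to A x : R := inf [set enorm (x - y) | y in A].

Definition frontier A : set 'rV[R]_n := closure A `\` interior A.

Definition cube : set 'rV[R]_n := [set x | forall i, 0 <= x ord0 i < 1].

Definition open_cube : set 'rV[R]_n := [set x | forall i, 0 < x ord0 i < 1].

Definition e_ (i : 'I_n) : 'rV[R]_n := delta_mx ord0 i.

Definition periodic (T : Type) (f : 'rV[R]_n -> T) : Prop :=
  forall x i, f (x + e_ i) = f x.

Definition periodic_ext A : set 'rV[R]_n :=
  [set x | exists z : 'rV[int]_n, A (x - map_mx intr z)].

Fixpoint Ck (k : nat) f : Prop :=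
  match k with
  | 0 => continuous f
  | k'.+1 => continuous f /\
      forall i, (forall x, derivable f x (e_ i)) /\ Ck k' ('D_(e_ i) f)
  end.

Definition grad f x : 'rV[R]_n := \row_i 'D_(e_ i) f x.

Definition hess f x : 'M[R]_n := \matrix_(i, j) 'D_(e_ j) ('D_(e_ i) f) x.

Definition laplacian f x : R := \tr (hess f x).

Definition divergence (X : 'rV[R]_n -> 'rV[R]_n) x : R :=
  \sum_i 'D_(e_ i) (fun y => X y ord0 i) x.

Definition supp (T : zmodType) (f : 'rV[R]_n -> T) : set 'rV[R]_n :=
  closure [set x | f x != 0].

End euclidean.

Section geometric_measure_theory.
Context {R : realType} {n : nat}.
Implicit Types (A B U V : set 'rV[R]_n).

Definition unit_ball_volume (m : nat) : R :=
  fine (leb m (eball (0 : 'rV[R]_m) 1)).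

Definition diam A : R := sup [set enorm (p.1 - p.2) | p in A `*` A].

(* The bound on the distances forces every C j to be bounded, so that diam
   is the true diameter (and 0 for the empty set). *)
Definition hausdorff_pre (m : nat) (delta : R) A : \bar R :=
  ereal_inf
    [set (\sum_(0 <= j <oo)
            (unit_ball_volume m * (diam (C j) / 2) ^+ m)%:E)%E
     | C in [set C : (set 'rV[R]_n)^nat |
         A `<=` \bigcup_j C j /\
         forall j x y, C j x -> C j y -> enorm (x - y) <= delta]].

Definition hausdorff (m : nat) A : \bar R :=
  ereal_sup [set hausdorff_pre m delta A | delta in [set delta : R | 0 < delta]].

(* ||grad chi_A||(V) for V open. *)
Definition perimeter_in A V : \bar R :=
  ereal_sup
    [set (\int[leb n]_(x in A) (divergence X x)%:E)%E
     | X in [set X : 'rV[R]_n -> 'rV[R]_n |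
         [/\ forall i, Ck 1 (fun x => X x ord0 i), compact (supp X),
             supp X `<=` V & forall x, enorm (X x) <= 1]]].

(* The total variation measure ||grad chi_A||, on arbitrary sets by outer
   regularity. *)
Definition tv_measure A B : \bar R :=
  ereal_inf [set perimeter_in A V | V in [set V | open V /\ B `<=` V]].

Definition measures_cvg (nu_ : nat -> set 'rV[R]_n -> \bar R)
    (nu : set 'rV[R]_n -> \bar R) : Prop :=
  forall f : 'rV[R]_n -> R, continuous f -> compact (supp f) ->
    (\int[nu_ i]_x (f x)%:E)%E @[i --> \oo] --> (\int[nu]_x (f x)%:E)%E.

(* Near each boundary point, U is the region on one side of the graph of a
   C^3 function of the n - 1 coordinates other than the k-th. *)
Definition C3_boundary U : Prop :=
  forall x, frontier U x ->
    exists (k : 'I_n) (s : bool) (r : R) (g : 'rV[R]_n.-1 -> R),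
      [/\ 0 < r, Ck 3 g &
          forall y, eball x r y ->
            (U y <-> 0 < (-1) ^+ s * (y ord0 k - g (col' k y)))].

End geometric_measure_theory.

Section phase_field.
Context {R : realType}.

Definition W (s : R) : R := (1 - s ^+ 2) ^+ 2 / 2.

Definition sqrt2W (s : R) : R := Num.sqrt (2 * W s).

(* The integral of sqrt2W from 0 to s. *)
Definition kfun (s : R) : R :=
  if 0 <= s then \int[lebesgue_measure]_(tau in `[0, s]) sqrt2W tau
  else - \int[lebesgue_measure]_(tau in `[s, 0]) sqrt2W tau.

Definition sigma : R := \int[lebesgue_measure]_(s in `[-1, 1]) sqrt2W s.

Definition tanh (s : R) : R := (expR s - expR (- s)) / (expR s + expR (- s)).

Definition q (eps r : R) : R := tanh (r / eps).

Context {d : nat}.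
Implicit Types (u : 'rV[R]_d -> R) (U : set 'rV[R]_d) (phi : 'rV[R]_d -> R -> R).

(* The initial set U_0 and its approximations U_0^i.  The density bound is
   about M_0 = frontier U0 itself and not about its periodic extension, whose
   area in B_R grows like R^d; perimeters are those of the periodic
   extensions. *)
Definition initial_set (D0 : R) (U0 : set 'rV[R]_d)
    (U : nat -> set 'rV[R]_d) : Prop :=
  [/\ open U0,
      closure U0 `<=` open_cube,
      forall (x : 'rV[R]_d) (r : R), 0 < r ->
        (hausdorff d.-1 (frontier U0 `&` eball x r)
           <= (D0 * (unit_ball_volume d.-1 * r ^+ d.-1))%:E)%E,
      forall i, [/\ open (U i), U i `<=` open_cube & C3_boundary (U i)] &
      (leb d ((U0 `\` U i) `|` (U i `\` U0)) @[i --> \oo] --> 0%E) /\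
      measures_cvg (fun i => tv_measure (periodic_ext (U i)))
        (tv_measure (periodic_ext U0))].

Definition signed_dist U (x : 'rV[R]_d) : R :=
  if x \in periodic_ext U then dist_to (periodic_ext (frontier U)) x
  else - dist_to (periodic_ext (frontier U)) x.

(* rbar is C^3, the regularity of the signed distance near a C^3 boundary;
   the bound on the Hessian is in operator norm. *)
Definition smoothed_dist (eps : R) U (rbar : 'rV[R]_d -> R) : Prop :=
  [/\ Ck 3 rbar,
      periodic rbar,
      forall x, enorm (grad rbar x) <= 1,
      forall x v, enorm (v *m hess rbar x) <= eps^-1 * enorm v &
      exists N : set 'rV[R]_d,
        [/\ open N, periodic_ext (frontier U) `<=` N &
            forall x, N x -> rbar x = signed_dist U x]].

Definition lambda_of (eps : R) u : R :=
  (- \int[leb d]_(x in cube)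
       (sqrt2W (u x) * (eps * laplacian u x - derive1 W (u x) / eps)))
  / (2 * \int[leb d]_(x in cube) W (u x)).

Definition slice phi (t : R) : 'rV[R]_d -> R := fun x => phi x t.

Definition lambda (eps : R) phi (t : R) : R := lambda_of eps (slice phi t).

(* Continuous on R^d x [0, oo), and C^2 in x and C^1 in t on R^d x (0, oo). *)
Definition C21 phi : Prop :=
  [/\ {within [set p : 'rV[R]_d * R | 0 <= p.2],
         continuous (fun p : 'rV[R]_d * R => phi p.1 p.2)},
      forall x t, 0 < t -> derivable (phi x) t 1,
      forall x t i, 0 < t -> derivable (slice phi t) x (e_ i),
      forall x t i j, 0 < t -> derivable ('D_(e_ i) (slice phi t)) x (e_ j) &
      forall p : 'rV[R]_d * R, 0 < p.2 ->
        [/\ {for p, continuous (fun p : 'rV[R]_d * R => derive1 (phi p.1) p.2)},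
            forall i, {for p, continuous (fun p : 'rV[R]_d * R =>
              'D_(e_ i) (slice phi p.2) p.1)} &
            forall i j, {for p, continuous (fun p : 'rV[R]_d * R =>
              'D_(e_ j) ('D_(e_ i) (slice phi p.2)) p.1)}]].

Definition is_solution (eps : R) (phi0 : 'rV[R]_d -> R) phi : Prop :=
  [/\ C21 phi,
      forall t, 0 <= t -> periodic (slice phi t),
      forall x, phi x 0 = phi0 x &
      forall x t, 0 < t ->
        eps * derive1 (phi x) t =
          eps * laplacian (slice phi t) x - derive1 W (phi x t) / eps
          + lambda eps phi t * sqrt2W (phi x t)].

(* mu_t^eps as a set function, u being phi^eps(., t). *)
Definition mu (eps : R) u (A : set 'rV[R]_d) : \bar R :=
  ((sigma^-1)%:E *
   \int[leb d]_(x in A)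
     (eps * enorm (grad u x) ^+ 2 / 2 + W (u x) / eps)%:E)%E.

Definition standing_bounds (omega D1 eps : R) u : Prop :=
  [/\ `| \int[leb d]_(x in cube) kfun (u x) | <= 2 / 3 - omega,
      (mu eps u cube <= D1%:E)%E &
      forall x (r : R), 0 < r <= 1 ->
        (mu eps u (eball x r) <=
           (D1 * (unit_ball_volume d.-1 * r ^+ d.-1))%:E)%E].

End phase_field.

(* Main.v *)
Require Import Defs.
From mathcomp Require Import all_boot all_order all_algebra.
From mathcomp Require Import all_classical all_reals all_analysis.
From mathcomp Require Import measurable_realfun.
From mathcomp Require Import ring lra.
Import Order.TTheory GRing.Theory Num.Theory.
Import numFieldNormedType.Exports.
Local Open Scope classical_set_scope.
Local Open Scope ring_scope.
Set Implicit Arguments.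
Unset Strict Implicit.
Unset Printing Implicit Defensive.

(** Put F = eps Lap phi - W'(phi) / eps. The integrand of the estimate is
    F^2 / eps, and the equation reads eps phi_t = F + lambda sqrt(2W(phi)).
    The multiplier lambda is the one for which the integral of
    sqrt(2W(phi)) phi_t vanishes, so that the energy
    E = int (eps |grad phi|^2 / 2 + W(phi) / eps) satisfies

      E' = - int F phi_t = - eps int phi_t^2 <= 0  and
      int F phi_t = int F^2 / eps - 2 lambda^2 int W(phi) / eps

    (is_derive_energy, dissipation_ge0, dissipationE). As
    int W(phi) / eps <= E(t) <= E(0) <= sigma D1, integration in time gives
    int_0^T int F^2 / eps <= E(0) (1 + 2 int_0^T lambda^2), and the bound on
    lambda in L^2(0, T) concludes (chem_sqr_integral).

    Two steps of this computation are not mere calculus.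

    The gradient of phi is not known to be differentiable in time, so the
    Dirichlet energy P cannot be differentiated under the integral sign.
    Convexity and Green's formula give
    P(u) - P(v) <= - int Lap u (u - v) for all u and v (dirichlet_convex);
    exchanging u and v squeezes the difference quotients of P along the flow
    between two quantities with the same limit (is_derive_dirichlet).

    The solution is only continuous up to t = 0, and the uniform convergence of
    phi(t) to phi(0) gives no more than the lower semicontinuity of P, the wrong
    direction for E(t) <= E(0). Suppose that P(t) > P(0) + eta for all small t,
    and let psi(t) = phi(t) - phi(0), f = phi_t - Lap phi,
    y = int psi^2 / 2. Then y' = int psi Lap phi + int psi f; the first term
    is at most P(0) - P(t) < - eta by convexity, the second one at most
    eta + y (int f^2) / (2 eta) by the inequalities of Cauchy-Schwarz and
    Young. Since int f^2 <= K (1 + lambda^2) for t <= 1 is integrable in time and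
    y(0) = 0, Gronwall's inequality yields psi = 0 for small t, which is absurd.
    Hence P(t) <= P(0) + eta for arbitrarily small t (dirichlet_limit), and the
    monotonicity of E gives E(t) <= E(0) for all t (energy_le_initial).

    Integrations by parts on the torus rest on the invariance of the integral
    over the unit cube under translations of a periodic function
    (ge0_integral_cube_translate): the integral of g(x + t e_i) over the cube
    does not depend on t, and its derivative in t is the integral of the i-th
    partial derivative of g. *)

(** * Translation invariance of the integral over the unit cube *)

Section translation1.
Context {R : realType}.
Local Notation mu := (@lebesgue_measure R).

Let measurable_shift (a : R) :
  measurable_fun setT ((fun x => x + a) : measurableTypeR R -> measurableTypeR R).
Proof. by apply: measurable_funD => //; exact: measurable_cst. Qed.

Lemma lebesgue_measure_translate (a : R) (A : set R) : measurable A ->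
  pushforward mu ((fun x => x + a) : measurableTypeR R -> measurableTypeR R) A = mu A.
Proof.
pose nu : {measure set _ -> \bar R} :=
  @measure_function_pushforward__canonical__measure_function_Measure
    _ _ _ _ _ mu _ (measurable_shift a).
move=> mA; apply/esym/(@lebesgue_measure_unique _ nu) => // _ [[b c]] _ <-.
rewrite /nu/= /pushforward/= (_ : _ @^-1` _ = `]b - a, c - a]%classic).
  rewrite !lebesgue_measure_itv/= !lte_fin ltrD2r.
  by case: ifPn => // _; rewrite -!EFinD opprB addrA subrK.
by apply/seteqP; split => x /=; rewrite !in_itv/= ltrBlDr lerBrDr.
Qed.

Lemma ge0_integral_translate_itv (f : measurableTypeR R -> \bar R) (a b c : R) :
  measurable_fun setT f -> (forall x, 0 <= f x)%E ->
  (\int[mu]_(x in `[b, c[) f (x + a)%R =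
   \int[mu]_(x in `[(b + a)%R, (c + a)%R[) f x)%E.
Proof.
move=> mf f0.
rewrite (_ : `[b, c[%classic =
    ((fun x => x + a) : _ -> measurableTypeR R) @^-1` `[b + a, c + a[); last first.
  by apply/seteqP; split => x /=; rewrite !in_itv/= lerD2r ltrD2r.
rewrite -(@ge0_integral_pushforward _ _ _ _ _ _ (measurable_shift a))//=; last first.
  exact: measurable_funS mf.
pose nu : {measure set _ -> \bar R} :=
  @measure_function_pushforward__canonical__measure_function_Measure
    _ _ _ _ _ mu _ (measurable_shift a).
apply: (@eq_measure_integral _ _ _ _ mu nu) => A mA _.
exact: lebesgue_measure_translate.
Qed.


(** For 0 <= a <= 1 the shift moves the window [0, 1[ to [a, 1 + a[, and
    periodicity brings the part [1, 1 + a[ back to [0, a[. *)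
Lemma ge0_integral_periodic_translate (f : measurableTypeR R -> \bar R) (a : R) :
  measurable_fun setT f -> (forall x, 0 <= f x)%E ->
  (forall x, f (x + 1) = f x) -> `|a| <= 1 ->
  (\int[mu]_(x in `[0%R, 1%R[) f (x + a)%R = \int[mu]_(x in `[0%R, 1%R[) f x)%E.
Proof.
move=> mf f0 f1.
have main b : 0 <= b <= 1 ->
  (\int[mu]_(x in `[0%R, 1%R[) f (x + b)%R = \int[mu]_(x in `[0%R, 1%R[) f x)%E.
  move=> /andP[b0 b1].
  have split_itv (u v w : R) : u <= v -> v <= w ->
    (\int[mu]_(x in `[u, w[) f x =
     \int[mu]_(x in `[u, v[) f x + \int[mu]_(x in `[v, w[) f x)%E.
    move=> uv vw.
    rewrite (_ : `[u, w[%classic = `[u, v[ `|` `[v, w[); last first.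
      by rewrite (@itv_bndbnd_setU _ _ (BLeft u) (BLeft v) (BLeft w)).
    rewrite ge0_integral_setU//=; first exact: measurable_funS mf.
    apply/disj_setPS => x/= [].
    by rewrite !in_itv/= => /andP[_ xv] /andP[vx _]; move: (lt_le_trans xv vx);
      rewrite ltxx.
  rewrite ge0_integral_translate_itv// add0r (split_itv b 1 (1 + b))// ?lerDl//.
  rewrite (split_itv 0 b 1)// addeC; congr (_ + _)%E.
  rewrite [1 + b]addrC -{1}[1]add0r -ge0_integral_translate_itv//.
  by apply: eq_integral => x _; rewrite f1.
move=> a1; have [a0|a0] := leP 0 a.
  by apply: main; rewrite a0/=; move: a1; rewrite ger0_norm.
rewrite -(main (a + 1)); last by move: a1; rewrite ltr0_norm//; lra.
by apply: eq_integral => x _; rewrite addrA f1.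
Qed.

End translation1.

Section cube_integral.
Context {R : realType}.
Local Notation mu := (@lebesgue_measure R).

Lemma rV_cons0 n (p : measurableTypeR R * 'rV[R]_n) : rV_cons p ord0 ord0 = p.1.
Proof.
rewrite /rV_cons (_ : (ord0 : 'I_n.+1) = lshift n (ord0 : 'I_1)); last exact/val_inj.
by rewrite (@row_mxEl _ 1 1 n) mxE.
Qed.

Lemma rV_consS n (p : measurableTypeR R * 'rV[R]_n) (j : 'I_n) :
  rV_cons p ord0 (lift ord0 j) = p.2 ord0 j.
Proof.
rewrite /rV_cons (_ : lift ord0 j = rshift 1 j); last exact/val_inj.
by rewrite (@row_mxEr _ 1 1 n).
Qed.

Let rV_shiftE n (x : 'rV[R]_n) b (j i : 'I_n) :
  (x + b *: e_ j) ord0 i = x ord0 i + b * (i == j)%:R.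
Proof. by rewrite !mxE. Qed.

Lemma rV_consD0 n a b (y : 'rV[R]_n) :
  rV_cons (a + b, y) = rV_cons (a, y) + b *: e_ ord0.
Proof.
apply/rowP => i; rewrite rV_shiftE; case: (unliftP ord0 i) => [j|] ->.
  by rewrite !rV_consS/= mulr0 addr0.
by rewrite !rV_cons0/= mulr1.
Qed.

Lemma rV_consDS n a (y : 'rV[R]_n) b (j : 'I_n) :
  rV_cons (a, y + b *: e_ j) = rV_cons (a, y) + b *: e_ (lift ord0 j).
Proof.
apply/rowP => i; rewrite rV_shiftE; case: (unliftP ord0 i) => [k|] ->.
  by rewrite !rV_consS/= rV_shiftE (inj_eq (@lift_inj _ ord0)).
by rewrite !rV_cons0/= mulr0 addr0.
Qed.

Lemma measurable_cube n : measurable (cube : set 'rV[R]_n).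
Proof.
rewrite (_ : cube = \bigcap_(i in [set: 'I_n]) (rV_coord i @^-1` `[0, 1[)).
  apply: fin_bigcap_measurable => [|i _]; first exact: finite_finset.
   rewrite -[X in measurable X]setTI.
  by apply: measurable_rV_coord.
apply/seteqP; split => x /=.
  by move=> cx i _ /=; rewrite in_itv; exact: cx.
by move=> cx i; have := cx i Logic.I; rewrite /= in_itv.
Qed.

Lemma cube_cons n (a : R) (y : 'rV[R]_n) :
  cube (rV_cons (a, y)) <-> `[0%R, 1%R[%classic a /\ cube y.
Proof.
split=> [c|[c0 cS] i].
  split; first by have := c ord0; rewrite rV_cons0 /= in_itv.
  by move=> i; have := c (lift ord0 i); rewrite rV_consS.
case: (unliftP ord0 i) => [j|] ->; first by rewrite rV_consS; exact: cS.
by rewrite rV_cons0 /=; move: c0; rewrite /= in_itv.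
Qed.

Section tonelli.
Variables (n : nat) (f : 'rV[R]_n.+1 -> \bar R).
Hypotheses (mf : measurable_fun setT f) (f0 : forall x, (0 <= f x)%E).

Let g (p : measurableTypeR R * 'rV[R]_n) : \bar R := (f \_ cube) (rV_cons p).

Let mg : measurable_fun setT g.
Proof.
apply: (measurableT_comp _ (@measurable_rV_cons R n)).
apply/(measurable_restrictT _ (@measurable_cube n.+1)).
exact: measurable_funS mf.
Qed.

Let g0 p : (0 <= g p)%E.
Proof. by rewrite /g; apply: erestrict_ge0. Qed.

Lemma measurable_cube_slice :
  measurable_fun setT (fun a => \int[leb n]_(y in cube) f (rV_cons (a, y)))%E.
Proof.
pose h (p : measurableTypeR R * 'rV[R]_n) : \bar R :=
  ((f \o @rV_cons R n) \_ (setT `*` cube)) p.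
have mh : measurable_fun setT h.
  have mc : measurable ([set: measurableTypeR R] `*` (cube : set 'rV[R]_n)).
    by apply: measurableX => //; exact: measurable_cube.
  apply/(measurable_restrictT _ mc).
  apply: measurable_funTS; apply: measurableT_comp => //; exact: measurable_rV_cons.
have h0 p : (0 <= h p)%E by apply: erestrict_ge0 => q _; exact: f0.
rewrite (_ : (fun _ => _) = fubini_F (leb n) h).
  exact: measurable_fun_fubini_tonelli_F.
apply/funext => a; rewrite integral_mkcond; apply: eq_integral => y _.
rewrite /h !patchE; congr (if _ then _ else _).
by apply/idP/idP => /set_mem cy; apply/mem_set => //; case: cy.
Qed.

(** For nonnegative functions Tonelli's theorem needs no integrability, and
    the iterated integrals stay meaningful in every dimension. *)
Lemma ge0_integral_cubeS :
  (\int[leb n.+1]_(x in cube) f x =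
   \int[mu]_(a in `[0%R, 1%R[) \int[leb n]_(y in cube) f (rV_cons (a, y)))%E.
Proof.
rewrite integral_mkcond.
transitivity (\int[(mu \x leb n)%E]_p g p)%E.
  rewrite [LHS]ge0_integral_pushforward//=.
  - exact: measurable_rV_cons.
  - apply/(measurable_restrictT _ (@measurable_cube n.+1)).
    exact: measurable_funS mf.
  - by move=> x _; apply: erestrict_ge0.
rewrite fubini_tonelli1// [RHS]integral_mkcond.
apply: eq_integral => a _.
rewrite /fubini_F patchE; case: ifPn => a01.
  rewrite [RHS]integral_mkcond; apply: eq_integral => y _.
  rewrite /g !patchE; congr (if _ then _ else _).
  apply/idP/idP => /set_mem cy; apply/mem_set; first by case/cube_cons: cy.
  by apply/cube_cons; split => //; exact: set_mem.
rewrite integral0_eq// => y _; rewrite /g patchE ifN//.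
by apply: contra a01; rewrite !inE => /cube_cons[].
Qed.

End tonelli.

(** Induction on the dimension: a shift of the first coordinate is the
    one-dimensional case, any other shift acts inside the inner integral. *)
Lemma ge0_integral_cube_translate n (i : 'I_n) (h : R) (f : 'rV[R]_n -> \bar R) :
  measurable_fun setT f -> (forall x, 0 <= f x)%E -> Defs.periodic f -> `|h| <= 1 ->
  (\int[leb n]_(x in cube) f (x + h *: e_ i)%R = \int[leb n]_(x in cube) f x)%E.
Proof.
elim: n => [|n IH] in i f * => mf f0 pf h1; first by case: i.
have mfh : measurable_fun setT (fun x : 'rV[R]_n.+1 => f (x + h *: e_ i)).
  apply: measurableT_comp => //; apply: measurable_fun_rVP => j.
  rewrite (_ : _ \o _ = fun x : 'rV[R]_n.+1 => rV_coord j x + (h *: e_ i) ord0 j).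
    by apply: measurable_funD; [exact: measurable_rV_coord|exact: measurable_cst].
  by apply/funext => x; rewrite /= /rV_coord mxE.
rewrite !ge0_integral_cubeS//.
case: (unliftP ord0 i) => [j|] ->.
  apply: eq_integral => a _.
  under eq_integral do rewrite -rV_consDS.
  apply: (IH j (fun y => f (rV_cons (a, y)))) => //.
    apply: measurableT_comp => //.
    by apply: measurableT_comp; [exact: measurable_rV_cons|exact: pair1_measurable].
  by move=> y k; rewrite -[e_ k]scale1r rV_consDS scale1r pf.
under eq_integral do under eq_integral do rewrite -rV_consD0.
apply: (@ge0_integral_periodic_translate _
  (fun a => \int[leb n]_(y in cube) f (rV_cons (a, y)))%E) => //.
- exact: measurable_cube_slice.
- by move=> a; exact: integral_ge0.
- by move=> a; apply: eq_integral => y _; rewrite rV_consD0 scale1r pf.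
Qed.

Lemma leb_cube n : leb n (cube : set 'rV[R]_n) = 1%E.
Proof.
elim: n => [|n IH].
  have c0 : cube (0 : 'rV[R]_0) by case.
  rewrite /leb/= diracE mem_set//.
transitivity (\int[leb n.+1]_(x in (cube : set 'rV[R]_n.+1)) 1)%E.
  by rewrite integral_cst ?mul1e//; exact: measurable_cube.
rewrite ge0_integral_cubeS//.
have E : (\int[leb n]_(y in (cube : set 'rV[R]_n)) 1 = 1)%E.
  by rewrite integral_cst ?IH ?mul1e//; exact: measurable_cube.
under eq_integral do rewrite E.
by rewrite integral_cst//= mul1e lebesgue_measure_itv/= lte_fin ltr01 oppr0 adde0.
Qed.
End cube_integral.

(** * Integrals of continuous functions over the unit cube *)

(** Continuity of pointwise sums and products, written for explicit lambda
    expressions so that the rules apply to integrands as they stand. *)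
Section continuity_at_a_point.
Context {R : realType} {T : topologicalType}.
Implicit Types (f g : T -> R) (x : T).

Lemma continuous_atD f g x : {for x, continuous f} -> {for x, continuous g} ->
  {for x, continuous (fun y => f y + g y)}.
Proof. by move=> cf cg; exact: (@continuousD _ _ _ f g x cf cg). Qed.

Lemma continuous_atB f g x : {for x, continuous f} -> {for x, continuous g} ->
  {for x, continuous (fun y => f y - g y)}.
Proof. by move=> cf cg; exact: (@continuousB _ _ _ f g x cf cg). Qed.

Lemma continuous_atM f g x : {for x, continuous f} -> {for x, continuous g} ->
  {for x, continuous (fun y => f y * g y)}.
Proof. by move=> cf cg; exact: (@continuousM _ _ f g x cf cg). Qed.

Lemma continuous_at_cst (c : R) x : {for x, continuous (fun=> c)}.
Proof. exact: cvg_cst. Qed.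

Lemma continuous_atZ (c : R) f x : {for x, continuous f} ->
  {for x, continuous (fun y => c * f y)}.
Proof. by apply: continuous_atM; exact: continuous_at_cst. Qed.

Lemma continuous_atX f k x : {for x, continuous f} ->
  {for x, continuous (fun y => f y ^+ k)}.
Proof.
move=> cf; elim: k => [|k IH].
  by under [X in {for x, continuous X}]eq_fun do rewrite expr0;
    exact: continuous_at_cst.
by under [X in {for x, continuous X}]eq_fun do rewrite exprS; exact: continuous_atM.
Qed.

Lemma continuous_at_sum (I : Type) (s : seq I) (F : I -> T -> R) x :
  (forall i, {for x, continuous (F i)}) ->
  {for x, continuous (fun y => \sum_(i <- s) F i y)}.
Proof.
move=> cF; elim: s => [|i s IH].
  by under [X in {for x, continuous X}]eq_fun do rewrite big_nil;
    exact: continuous_at_cst.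
under [X in {for x, continuous X}]eq_fun do rewrite big_cons.
by apply: continuous_atD => //; exact: cF.
Qed.

Lemma continuous_at_comp (h : R -> R) f x : {for f x, continuous h} ->
  {for x, continuous f} -> {for x, continuous (fun y => h (f y))}.
Proof. by move=> ch cf; exact: (continuous_comp cf ch). Qed.

End continuity_at_a_point.

Lemma continuous_at_pair (T U V : topologicalType) (f : T -> U) (g : T -> V) x :
  {for x, continuous f} -> {for x, continuous g} ->
  {for x, continuous (fun y => (f y, g y))}.
Proof. by move=> cf cg;
  exact: (@cvg_pair _ _ _ (nbhs x) (nbhs (f x)) (nbhs (g x))). Qed.

Section continuous_measurable.
Context {R : realType} {n : nat}.

(** An open set is the union of the countably many rational boxes that it
    contains, and a box is measurable coordinate by coordinate. *)
Lemma open_measurable_rV (U : set 'rV[R]_n) : open U -> measurable U.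
Proof.
move=> oU.
pose box (c : 'rV[rat]_n * nat) : set 'rV[R]_n :=
  [set y | forall i, `|ratr (c.1 ord0 i) - y ord0 i| < c.2.+1%:R^-1].
have mbox c : measurable (box c).
  rewrite (_ : box c = \bigcap_(i in [set: 'I_n])
      (rV_coord i @^-1` ball (ratr (c.1 ord0 i) : R) c.2.+1%:R^-1)).
    apply: fin_bigcap_measurable => [|i _]; first exact: finite_finset.
    rewrite -[X in measurable X]setTI.
    by apply: measurable_rV_coord => //; exact: measurable_ball.
  apply/seteqP; split => y /=.
    by move=> cy i _; rewrite /= -ball_normE; exact: cy.
  by move=> cy i; have := cy i Logic.I; rewrite /= -ball_normE.
rewrite (_ : U = \bigcup_c (if `[< box c `<=` U >] then box c else set0)).
  apply: countable_bigcupT_measurable; first exact: countableP.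
  by move=> c; case: ifPn.
apply/seteqP; split => [x Ux|x [c _]]; last first.
  by case: ifPn => // /asboolP; exact.
have /nbhs_ballP[e /= e0 xeU] : nbhs x U by exact: open_nbhs_nbhs.
have [k] := @ltr_add_invr R 0 (e / 2) (divr_gt0 e0 (ltr0n _ 2)).
rewrite add0r => ke.
have /choice[c cP] i : exists r : rat, `|ratr r - x ord0 i| < k.+1%:R^-1.
  have [r] := @rat_in_itvoo R (x ord0 i - k.+1%:R^-1) (x ord0 i + k.+1%:R^-1) ltac:(
    by rewrite ltrBlDr -addrA ltrDl addr_gt0// invr_gt0).
  rewrite in_itv/= => /andP[r1 r2]; exists r.
  by rewrite ltr_norml ltrBrDr ltrBlDr addrC r1 addrC r2.
exists (\row_i c i, k) => //; rewrite ifT; last first.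
  apply/asboolP => y yb; apply: xeU; split=> // i j.
  rewrite (ord1 i) -ball_normE/=.
  have := yb j; rewrite /= mxE => yj; rewrite (le_lt_trans (ler_distD (ratr (c j)) _ _))//.
  by rewrite (splitr e) ltrD// (lt_trans _ ke)// distrC.
by move=> i; rewrite /= mxE.
Qed.

Lemma continuous_measurable_rV (g : 'rV[R]_n -> R) :
  continuous g -> measurable_fun setT g.
Proof.
move=> /continuousP cg; apply: (measurability _ (RGenOpens.measurableE R)).
move=> _ [_ [a [b ->] <-]]; rewrite setTI.
by apply: open_measurable_rV; apply: cg; exact: interval_open.
Qed.

End continuous_measurable.

Section cubeint.
Context {R : realType} {n : nat}.
Implicit Types g h : 'rV[R]_n -> R.

Definition cubeint g : R := \int[leb n]_(x in cube) g x.

(** A compact set containing the half-open cube, on which uniform bounds are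
    taken. *)
Definition closed_cube : set 'rV[R]_n := [set x | forall i, `[0, 1]%classic (x ord0 i)].

Lemma compact_closed_cube : compact closed_cube.
Proof.
by apply: (@rV_compact R n (fun=> `[0, 1]%classic)) => i; exact: segment_compact.
Qed.

Lemma cube_closed_cube : cube `<=` closed_cube.
Proof. by move=> x cx i; have /andP[x0 /ltW x1] := cx i; rewrite /= in_itv/= x0. Qed.

Lemma continuous_cube_bounded g : continuous g ->
  exists2 M, 0 <= M & forall x, cube x -> `|g x| <= M.
Proof.
move=> cg; have /compact_bounded[M [Mr HM]] : compact (g @` closed_cube).
  apply: continuous_compact; last exact: compact_closed_cube.
  exact: continuous_subspaceT.
exists (`|M| + 1) => // x cx; apply: (HM (`|M| + 1)).
  by rewrite ltr_pwDr// ler_norm.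
by exists x => //; exact: cube_closed_cube.
Qed.

Lemma integrable_cube g : continuous g -> (leb n).-integrable cube (EFin \o g).
Proof.
move=> cg; apply: measurable_bounded_integrable.
- exact: measurable_cube.
- by rewrite [ltLHS](leb_cube n) ltry.
- by apply: measurable_funTS; exact: continuous_measurable_rV.
- have [M M0 HM] := continuous_cube_bounded cg.
  exists M; split; first exact: num_real.
  by move=> N MN x /= cx; rewrite (le_trans (HM _ cx))// ltW.
Qed.

Lemma cubeint_EFin g : continuous g ->
  (\int[leb n]_(x in cube) (g x)%:E = (cubeint g)%:E)%E.
Proof.
move=> cg; rewrite /cubeint /Rintegral fineK//.
by apply: integrable_fin_num; [exact: measurable_cube|exact: integrable_cube].
Qed.

Lemma cubeintD g h : continuous g -> continuous h ->
  cubeint (fun x => g x + h x) = cubeint g + cubeint h.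
Proof.
by move=> cg ch; apply: RintegralD; [exact: measurable_cube|exact: integrable_cube..].
Qed.

Lemma cubeintB g h : continuous g -> continuous h ->
  cubeint (fun x => g x - h x) = cubeint g - cubeint h.
Proof.
by move=> cg ch; apply: RintegralB; [exact: measurable_cube|exact: integrable_cube..].
Qed.

Lemma cubeintZ c g : continuous g -> cubeint (fun x => c * g x) = c * cubeint g.
Proof.
by move=> cg; apply: RintegralZl; [exact: measurable_cube|exact: integrable_cube].
Qed.

Lemma cubeint_cst c : cubeint (fun=> c) = c.
Proof.
rewrite /cubeint Rintegral_cst; last exact: measurable_cube.
by rewrite [fine _](congr1 fine (leb_cube n)) mulr1.
Qed.

Lemma cubeint_sum (I : Type) (s : seq I) (G : I -> 'rV[R]_n -> R) :
  (forall i, continuous (G i)) ->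
  cubeint (fun x => \sum_(i <- s) G i x) = \sum_(i <- s) cubeint (G i).
Proof.
move=> cG; elim: s => [|i s IH].
  by rewrite big_nil -[RHS](cubeint_cst 0); apply: eq_Rintegral => x _; rewrite big_nil.
rewrite big_cons -IH -cubeintD//.
  by apply: eq_Rintegral => x _; rewrite big_cons.
by move=> x; apply: continuous_at_sum => j; exact: cG.
Qed.

Lemma cubeint_le g h : continuous g -> continuous h -> (forall x, g x <= h x) ->
  cubeint g <= cubeint h.
Proof.
move=> cg ch gh; apply: le_Rintegral => //; first exact: measurable_cube.
- exact: integrable_cube.
- exact: integrable_cube.
Qed.

Lemma cubeint_ge0 g : (forall x, 0 <= g x) -> 0 <= cubeint g.
Proof. by move=> g0; exact: Rintegral_ge0. Qed.

Lemma cubeint_norm_le g c : continuous g -> (forall x, cube x -> `|g x| <= c) ->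
  `|cubeint g| <= c.
Proof.
move=> cg gc; rewrite (le_trans (le_normr_Rintegral _ _))//.
- exact: measurable_cube.
- exact: integrable_cube.
rewrite -[leRHS]cubeint_cst; apply: le_Rintegral => //; first exact: measurable_cube.
  by apply: (integrable_cube (g := fun x => `|g x|)) => x;
    apply: continuous_comp; [exact: cg|exact: norm_continuous].
by apply: (integrable_cube (g := cst c)); exact: cst_continuous.
Qed.

(** The invariance for nonnegative functions, applied to the positive and the
    negative parts. *)
Lemma cubeint_translate g (i : 'I_n) (t : R) : continuous g -> Defs.periodic g ->
  `|t| <= 1 -> cubeint (fun x => g (x + t *: e_ i)) = cubeint g.
Proof.
move=> cg pg t1; rewrite /cubeint /Rintegral; congr fine.
have mg : measurable_fun setT (EFin \o g).
  by apply/measurable_EFinP; exact: continuous_measurable_rV.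
rewrite integralE [RHS]integralE; congr (_ - _)%E.
  rewrite -(@ge0_integral_cube_translate _ _ i t ((EFin \o g)^\+%E))//.
  - by apply: eq_integral => x _; rewrite !funeposE.
  - exact: measurable_funepos.
  - by move=> x j; rewrite !funeposE/= pg.
rewrite -(@ge0_integral_cube_translate _ _ i t ((EFin \o g)^\-%E))//.
- by apply: eq_integral => x _; rewrite !funenegE.
- exact: measurable_funeneg.
- by move=> x j; rewrite !funenegE/= pg.
Qed.

End cubeint.

(** * Integrals depending on a parameter *)

Section parameter.
Context {R : realType} {n : nat}.
Implicit Types (G : 'rV[R]_n -> R -> R) (t : R).

(** Continuity in space and time at every point of the slice s = t: together
    with the compactness of the closed cube, this is what passing to the limit
    under the integral sign requires. *)
Definition jcont t G :=
  forall x, {for (x, t), continuous (fun p : 'rV[R]_n * R => G p.1 p.2)}.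

Lemma jcont_slice t G : jcont t G -> continuous (G^~ t).
Proof.
move=> cG x; apply: (@continuous_comp _ _ _ (fun x => (x, t)) (fun p => G p.1 p.2)).
  by apply: continuous_at_pair; [exact: cvg_id|exact: cst_continuous].
exact: cG.
Qed.

(** Compactness makes the convergence of G x s to G x t uniform on the closed
    cube. *)
Lemma cubeint_continuous t G : jcont t G ->
  (\forall s \near t, continuous (G^~ s)) ->
  {for t, continuous (fun s => cubeint (G^~ s))}.
Proof.
move=> cG nG; apply/cvgrPdist_le => e e0.
have cGt := jcont_slice cG.
have := @compact_closed_cube R n; rewrite compact_near_coveringP.
move=> /(_ _ (nbhs t) (fun s x => `|G x s - G x t| <= e) _) cover.
have sG : \forall s \near t, closed_cube `<=` (fun x => `|G x s - G x t| <= e).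
  apply: cover => /= x _.
  have e20 : 0 < e / 2 by rewrite divr_gt0.
  have /cvgrPdist_le/(_ _ e20)[[U V] /= [xU tV] UV] := cG x.
  exists (U, V) => // -[y s] [/= yU sV].
  have /= ys := UV (y, s) (conj yU sV).
  have /= yt := UV (y, t) (conj yU (nbhs_singleton tV)).
  by rewrite (le_trans (ler_distD (G x t) _ _))// [leRHS]splitr distrC lerD.
near=> s.
have cGs : continuous (G^~ s) by near: s.
rewrite -cubeintB//; apply: cubeint_norm_le.
  by move=> x; apply: continuous_atB; [exact: cGt|exact: cGs].
move=> x cx; rewrite distrC.
have : closed_cube `<=` (fun x => `|G x s - G x t| <= e) by near: s.
by apply; exact: cube_closed_cube.
Unshelve. all: by end_near. Qed.

(** Filling in the derivative at s = t turns the limit of the difference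
    quotients into a continuity statement. *)
Definition slope_at G (G' : 'rV[R]_n -> R -> R) t (x : 'rV[R]_n) (s : R) : R :=
  if s == t then G' x t else (G x s - G x t) / (s - t).

(** By the mean value theorem the slope at (y, s) is a value of G' y at a time
    between s and t. *)
Lemma jcont_slope t G G' :
  (\forall s \near t, forall x, is_derive (s : R) (1 : R) (G x) (G' x s)) ->
  jcont t G' -> jcont t (slope_at G G' t).
Proof.
move=> dG cG' x; apply/cvgrPdist_le => e e0.
have /cvgrPdist_le/(_ _ e0)[[U V] /= [xU tV] UV] := cG' x.
have [/= r r0 rV] :
    nbhs t (V `&` [set s | forall x, is_derive (s : R) (1 : R) (G x) (G' x s)]).
  exact: filterI.
exists (U, ball t r); first by split => //; exact: nbhsx_ballx.
move=> [y s] [/= yU sr]; rewrite /= {1}/slope_at eqxx /slope_at.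
case: ifPn => [_|st].
  by have /= := UV (y, t) (conj yU (nbhs_singleton tV)).
have itv_ball (a b : R) : ball t r a -> ball t r b -> forall c, c \in `[a, b] -> ball t r c.
  rewrite -ball_normE/= => ar br c; rewrite in_itv/= => /andP[ac cb].
  by move: ar br; rewrite !ltr_norml => /andP[a1 a2] /andP[b1 b2]; lra.
have slopeE (a b : R) : a < b -> ball t r a -> ball t r b ->
    exists2 c, ball t r c & (G y b - G y a) / (b - a) = G' y c.
  move=> ab ar br.
  have [||c cab E] := @MVT_segment R (G y) (G' y) a b (ltW ab).
  - move=> c cab; apply: (rV c _).2; apply: (itv_ball a b) => //.
    by move: cab; rewrite !in_itv/= => /andP[/ltW -> /ltW ->].
  - apply: derivable_within_continuous => c cab.
    by have [] := (rV c (itv_ball a b ar br c cab)).2 y.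
  exists c; first exact: (itv_ball a b).
  by rewrite E mulfK// subr_eq0 gt_eqF.
have [c cr ->] : exists2 c, ball t r c & (G y s - G y t) / (s - t) = G' y c.
  have tr : ball t r t by exact: ballxx.
  have [st'|ts|/eqP] := ltgtP s t; last by rewrite (negPf st).
    by rewrite -mulrNN -invrN !opprB; exact: slopeE.
  exact: slopeE.
by have /= := UV (y, c) (conj yU (rV c cr).1).
Qed.

Lemma cvg_shift_dnbhs (t : R) : (fun h => h + t) @ 0^' --> t.
Proof.
have : (fun h : R => h + t) @ nbhs (0 : R) --> 0 + t.
  by apply: cvgD; [exact: cvg_id|exact: cvg_cst].
by rewrite add0r; exact: cvg_within_filter.
Qed.

(** The difference quotient of the integral is the integral of the slope, which
    is continuous at time t. *)
Lemma cubeint_derive t G G' :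
  (\forall s \near t, forall x, is_derive (s : R) (1 : R) (G x) (G' x s)) ->
  jcont t G' -> (\forall s \near t, continuous (G^~ s)) ->
  is_derive t 1 (fun s => cubeint (G^~ s)) (cubeint (G'^~ t)).
Proof.
move=> dG cG' cG.
have cGt : continuous (G^~ t) by exact: nbhs_singleton cG.
have cS : {for t, continuous (fun s => cubeint ((slope_at G G' t)^~ s))}.
  apply: cubeint_continuous; first exact: jcont_slope.
  near=> s.
  have cGs : continuous (G^~ s) by near: s.
  have [->|st] := eqVneq s t; first exact/jcont_slice/jcont_slope.
  rewrite (_ : (slope_at G G' t)^~ s = fun x => (G x s - G x t) / (s - t));
    last first.
    by apply/funext => x; rewrite /slope_at (negPf st).
  move=> x;
    exact: (continuous_atM (continuous_atB (cGs x) (cGt x))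
    (@continuous_at_cst R _ (s - t)^-1 x)).
have shift_t := @cvg_shift_dnbhs t.
have slopeE h : h != 0 -> continuous (G^~ (h + t)) ->
    cubeint ((slope_at G G' t)^~ (h + t)) =
    h^-1 * (cubeint (G^~ (h + t)) - cubeint (G^~ t)).
  move=> h0 cGh; rewrite -cubeintB// -cubeintZ; last first.
    by move=> x; exact: (continuous_atB (cGh x) (cGt x)).
  apply: eq_Rintegral => x _.
  by rewrite /slope_at -subr_eq0 addrK (negPf h0) mulrC.
have lS : (fun h => h^-1 *: (((fun s => cubeint (G^~ s)) \o shift t) (h *: 1) -
    cubeint (G^~ t))) @ 0^' --> cubeint (G'^~ t).
  rewrite (_ : cubeint (G'^~ t) = cubeint ((slope_at G G' t)^~ t)); last first.
    by apply: eq_Rintegral => x _; rewrite /slope_at eqxx.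
  apply: cvg_trans (cvg_comp _ _ shift_t cS); apply: near_eq_cvg; near=> h.
  rewrite /= -[h *: 1]/(h * 1) mulr1; apply: slopeE.
    by near: h; exact: nbhs_dnbhs_neq.
  by near: h; exact: shift_t _ cG.
by apply: DeriveDef; [apply/cvg_ex; eexists; exact: lS|exact: cvg_lim lS].
Unshelve. all: by end_near. Qed.

Lemma is_derive_line (u : 'rV[R]_n -> R) x v (s l : R) :
  is_derive (x + s *: v) v u l <-> is_derive s (1 : R) (fun t => u (x + t *: v)) l.
Proof.
have E : (fun h : R => h^-1 *: (((fun t => u (x + t *: v)) \o shift s) (h *: 1) -
                                u (x + s *: v))) =
         (fun h : R => h^-1 *: ((u \o shift (x + s *: v)) (h *: v) - u (x + s *: v))).
  by apply/funext => h; rewrite /= scalerDl -[h *: 1]/(h * 1) mulr1 addrCA.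
split=> -[d1 d2]; apply: DeriveDef; move: d1 d2; rewrite /derivable /derive E//.
Qed.

Lemma continuous_translate (g : 'rV[R]_n -> R) (v : 'rV[R]_n) : continuous g ->
  continuous (fun x : 'rV[R]_n => g (x + v)).
Proof.
move=> cg x; apply: (@continuous_comp _ _ _ (fun x : 'rV[R]_n => x + v) g);
  last exact: cg.
by apply: (@continuousD R _ _ id (cst v) x); [exact: cvg_id|exact: cst_continuous].
Qed.

(** The integral of g (x + t *: e_ i) is constant in t, and its derivative at
    t = 0 is the integral of the partial derivative. *)
Lemma cubeint_partial_eq0 (g : 'rV[R]_n -> R) (i : 'I_n) :
  continuous g -> Defs.periodic g -> (forall x, derivable g x (e_ i)) ->
  continuous ('D_(e_ i) g) -> cubeint ('D_(e_ i) g) = 0.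
Proof.
move=> cg pg dg cdg.
pose G (x : 'rV[R]_n) (t : R) : R := g (x + t *: e_ i).
pose G' (x : 'rV[R]_n) (t : R) : R := 'D_(e_ i) g (x + t *: e_ i).
have GE x s : is_derive (s : R) (1 : R) (G x) (G' x s).
  by apply/is_derive_line; exact: derivableP.
have cG' t : jcont t G'.
  move=> x.
  have cD : {for (x, t), continuous (fun p : 'rV[R]_n * R => p.1 + p.2 *: e_ i)}.
    apply: (@continuousD R 'rV[R]_n ('rV[R]_n * R)%type fst
      (fun p => p.2 *: e_ i) (x, t));
      first exact: cvg_fst.
    by apply: (@continuousZr_tmp R 'rV[R]_n ('rV[R]_n * R)%type snd (e_ i));
      exact: cvg_snd.
  exact: (continuous_comp cD (cdg _)).
have nG : \forall s \near (0 : R), forall x, is_derive (s : R) (1 : R) (G x) (G' x s).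
  by near=> s => x; exact: GE.
have nc : \forall s \near (0 : R), continuous (G^~ s).
  by near=> s; exact: continuous_translate.
have [_ DE] := cubeint_derive nG (cG' 0) nc.
rewrite (_ : 'D_(e_ i) g = G'^~ 0); last first.
  by apply/funext => x; rewrite /G' scale0r addr0.
rewrite -DE; apply: cvg_lim => //.
apply: cvg_near_cst; near=> h.
have h1 : `|h| <= 1 by near: h; exact: dnbhs0_le.
rewrite /= -[h *: 1]/(h * 1) mulr1 addr0 (cubeint_translate i cg pg h1).
by rewrite (cubeint_translate i cg pg) ?normr0// subrr scaler0.
Unshelve. all: by end_near. Qed.

End parameter.

(** * Green's formula and convexity of the Dirichlet energy *)

Section integration_by_parts.
Context {R : realType} {n : nat}.
Implicit Types u v : 'rV[R]_n -> R.

Definition periodic_C1 u : Prop :=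
  [/\ continuous u, Defs.periodic u, forall x i, derivable u x (e_ i) &
      forall i, continuous ('D_(e_ i) u)].

Definition periodic_C2 u : Prop :=
  periodic_C1 u /\ forall i, periodic_C1 ('D_(e_ i) u).

Lemma partial_periodic u i : Defs.periodic u -> Defs.periodic ('D_(e_ i) u).
Proof.
move=> pu x j; rewrite /derive (_ : (fun h => h^-1 *: _) =
  fun h : R => h^-1 *: ((u \o shift x) (h *: e_ i) - u x))//.
by apply/funext => h; rewrite /= addrA !pu.
Qed.

Lemma periodic_C1B u v : periodic_C1 u -> periodic_C1 v ->
  periodic_C1 (fun x => u x - v x) /\
  forall i x, 'D_(e_ i) (fun x => u x - v x) x = 'D_(e_ i) u x - 'D_(e_ i) v x.
Proof.
move=> [cu pu du cdu] [cv pv dv cdv].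
have DE i x : 'D_(e_ i) (fun x => u x - v x) x = 'D_(e_ i) u x - 'D_(e_ i) v x.
  exact: (deriveB (du x i) (dv x i)).
split; [split|exact: DE].
- by move=> x; exact: (continuous_atB (cu x) (cv x)).
- by move=> x i; rewrite pu pv.
- by move=> x i; exact: (derivableB (du x i) (dv x i)).
- move=> i; rewrite (_ : 'D_(e_ i) _ = fun x => 'D_(e_ i) u x - 'D_(e_ i) v x).
    by move=> x; exact: (continuous_atB (cdu i x) (cdv i x)).
  by apply/funext => x; exact: DE.
Qed.

Lemma cubeint_by_parts u v i : periodic_C1 u -> periodic_C1 v ->
  cubeint (fun x => 'D_(e_ i) u x * v x) = - cubeint (fun x => u x * 'D_(e_ i) v x).
Proof.
move=> [cu pu du cdu] [cv pv dv cdv].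
have DE x : 'D_(e_ i) (fun x => u x * v x) x = 'D_(e_ i) u x * v x + u x * 'D_(e_ i) v x.
  have -> := deriveM (du x i) (dv x i).
  by rewrite addrC mulrC.
have c1 : continuous (fun x => 'D_(e_ i) u x * v x).
  by move=> x; exact: (continuous_atM (cdu i x) (cv x)).
have c2 : continuous (fun x => u x * 'D_(e_ i) v x).
  by move=> x; exact: (continuous_atM (cu x) (cdv i x)).
apply/eqP; rewrite -addr_eq0 -cubeintD//; apply/eqP.
rewrite (_ : (fun x => _) = 'D_(e_ i) (fun x => u x * v x)); last first.
  by apply/funext => x; rewrite DE.
apply: cubeint_partial_eq0.
- by move=> x; exact: (continuous_atM (cu x) (cv x)).
- by move=> x j; rewrite pu pv.
- by move=> x; exact: (derivableM (du x i) (dv x i)).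
- rewrite (_ : 'D_(e_ i) _ = fun x => 'D_(e_ i) u x * v x + u x * 'D_(e_ i) v x).
    by move=> x; exact: (continuous_atD (c1 x) (c2 x)).
  by apply/funext => x; exact: DE.
Qed.

Lemma laplacianE u x : laplacian u x = \sum_i 'D_(e_ i) ('D_(e_ i) u) x.
Proof. by rewrite /laplacian /mxtrace; apply: eq_bigr => i _; rewrite mxE. Qed.

Lemma green_formula u v : periodic_C2 u -> periodic_C1 v ->
  \sum_i cubeint (fun x => 'D_(e_ i) u x * 'D_(e_ i) v x) =
  - cubeint (fun x => laplacian u x * v x).
Proof.
move=> [c1u c2u] c1v; have [cv _ _ _] := c1v.
rewrite (eq_bigr (fun i => - cubeint (fun x => 'D_(e_ i) ('D_(e_ i) u) x * v x))).
  2: by move=> i _; rewrite (cubeint_by_parts i (c2u i) c1v) opprK.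
rewrite sumrN -cubeint_sum; last first.
  move=> i x; have [_ _ _ cd] := c2u i.
  exact: (continuous_atM (cd i x) (cv x)).
by congr (- _); apply: eq_Rintegral => x _; rewrite laplacianE mulr_suml.
Qed.

Definition dirichlet u : R := 2^-1 * \sum_i cubeint (fun x => ('D_(e_ i) u x) ^+ 2).

(** From (a^2 - b^2) / 2 <= a (a - b), applied to the partial derivatives, and
    Green's formula. This controls increments of the Dirichlet energy by those of
    its argument alone, without a time derivative of the gradient. *)
Lemma dirichlet_convex u v : periodic_C2 u -> periodic_C1 v ->
  dirichlet u - dirichlet v <= - cubeint (fun x => laplacian u x * (u x - v x)).
Proof.
move=> c2u c1v; have [c1u _] := c2u.
have [c1uv DE] := periodic_C1B c1u c1v.
rewrite -(green_formula c2u c1uv) /dirichlet -mulrBr -sumrB mulr_sumr.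
apply: ler_sum => i _.
have [_ _ _ /(_ i) cu] := c1u; have [_ _ _ /(_ i) cv] := c1v.
have [_ _ _ /(_ i) cuv] := c1uv.
have cu2 : continuous (fun x => 'D_(e_ i) u x ^+ 2).
  by move=> x; exact: (@continuous_atX R _ _ 2 x (cu x)).
have cv2 : continuous (fun x => 'D_(e_ i) v x ^+ 2).
  by move=> x; exact: (@continuous_atX R _ _ 2 x (cv x)).
have cuv2 : continuous (fun x => 'D_(e_ i) u x ^+ 2 - 'D_(e_ i) v x ^+ 2).
  by move=> x; exact: (continuous_atB (cu2 x) (cv2 x)).
rewrite -cubeintB// -cubeintZ//.
apply: cubeint_le.
- by move=> x; exact: (@continuous_atZ R _ 2^-1 _ x (cuv2 x)).
- by move=> x; exact: (continuous_atM (cu x) (cuv x)).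
- by move=> x; rewrite DE; have := sqr_ge0 ('D_(e_ i) u x - 'D_(e_ i) v x); nra.
Qed.

Lemma dirichlet_ge0 u : 0 <= dirichlet u.
Proof.
rewrite mulr_ge0// sumr_ge0// => i _.
by apply: cubeint_ge0 => x; exact: sqr_ge0.
Qed.

End integration_by_parts.

(** * The double well and the Cauchy-Schwarz inequality *)

Section double_well.
Context {R : realType}.

Lemma W_ge0 (s : R) : 0 <= W s.
Proof. by rewrite /W divr_ge0// sqr_ge0. Qed.

Lemma sqrt2W_sqr (s : R) : sqrt2W s ^+ 2 = 2 * W s.
Proof. by rewrite /sqrt2W sqr_sqrtr// mulr_ge0// W_ge0. Qed.

Lemma is_derive_W (s : R) : is_derive s (1 : R) (@W R) (2 * s * (s ^+ 2 - 1)).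
Proof.
rewrite (_ : @W R = 2^-1 \*: ((cst 1 - id ^+ 2) ^+ 2)); last first.
  by apply/funext => x; rewrite /W mulrC.
apply: is_derive_eq.
by rewrite /GRing.scale/= /cst !fctE !expr1; field.
Qed.

Lemma derive1_W (s : R) : derive1 W s = 2 * s * (s ^+ 2 - 1).
Proof. by rewrite derive1E; have [_ ->] := is_derive_W s. Qed.

Lemma derive1_W_continuous : continuous (derive1 (@W R)).
Proof.
rewrite (_ : derive1 _ = fun s : R => 2 * s * (s ^+ 2 - 1)); last first.
  by apply/funext => s; rewrite derive1_W.
move=> s; apply: continuous_atM; first by apply: continuous_atZ; exact: cvg_id.
by apply: continuous_atB; [apply: continuous_atX;
  exact: cvg_id|exact: continuous_at_cst].
Qed.

Lemma W_continuous : continuous (@W R).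
Proof.
move=> s; apply/differentiable_continuous/derivable1_diffP.
by have [] := is_derive_W s.
Qed.

Lemma sqrt2W_continuous : continuous (@sqrt2W R).
Proof.
move=> s; apply: (@continuous_at_comp _ _ (@Num.sqrt R) (fun s => 2 * W s)).
  exact: sqrt_continuous.
by apply: continuous_atZ; exact: W_continuous.
Qed.

End double_well.

Section cauchy_schwarz.
Context {R : realType} {n : nat}.
Implicit Types u v : 'rV[R]_n -> R.

(** Discriminant of the nonnegative quadratic form int (r u - s v)^2. *)
Lemma cubeint_cauchy_schwarz u v : continuous u -> continuous v ->
  cubeint (fun x => u x * v x) ^+ 2 <=
  cubeint (fun x => u x ^+ 2) * cubeint (fun x => v x ^+ 2).
Proof.
move=> cu cv.
set a := cubeint (fun x => u x ^+ 2); set b := cubeint (fun x => v x ^+ 2).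
set c := cubeint (fun x => u x * v x).
have cuv : continuous (fun x => u x * v x).
  by move=> x; exact: (continuous_atM (cu x) (cv x)).
have cu2 : continuous (fun x => u x ^+ 2).
  by move=> x; exact: (@continuous_atX R _ _ 2 x (cu x)).
have cv2 : continuous (fun x => v x ^+ 2).
  by move=> x; exact: (@continuous_atX R _ _ 2 x (cv x)).
have Q r s : 0 <= r ^+ 2 * a - 2 * r * s * c + s ^+ 2 * b.
  rewrite -!cubeintZ//.
  have c1 : continuous (fun x => r ^+ 2 * u x ^+ 2).
    by move=> x; exact: (@continuous_atZ R _ _ _ x (cu2 x)).
  have c2 : continuous (fun x => 2 * r * s * (u x * v x)).
    by move=> x; exact: (@continuous_atZ R _ _ _ x (cuv x)).
  have c3 : continuous (fun x => s ^+ 2 * v x ^+ 2).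
    by move=> x; exact: (@continuous_atZ R _ _ _ x (cv2 x)).
  rewrite -cubeintB// -cubeintD//; last by move=> x;
    exact: (continuous_atB (c1 x) (c2 x)).
  apply: cubeint_ge0 => x.
  by rewrite (_ : _ + _ = (r * u x - s * v x) ^+ 2) ?sqr_ge0//; ring.
have a0 : 0 <= a by apply: cubeint_ge0 => x; exact: sqr_ge0.
have b0 : 0 <= b by apply: cubeint_ge0 => x; exact: sqr_ge0.
have [b_eq0|b_neq0] := eqVneq b 0.
  (* With b = 0 the form is r^2 a - 2 r c; a + 1 stands in for a, which may be 0. *)
  have := Q ((a + 1)^-1 * c) 1; rewrite b_eq0 !mulr0 addr0.
  have a1 : 0 < a + 1 by lra.
  have -> : ((a + 1)^-1 * c) ^+ 2 * a - 2 * ((a + 1)^-1 * c) * 1 * c =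
            - ((a + 2) / (a + 1) ^+ 2 * c ^+ 2) by field; rewrite gt_eqF.
  rewrite oppr_ge0 pmulr_rle0//.
  by rewrite divr_gt0// ?exprn_gt0//; lra.
have b_gt0 : 0 < b by rewrite lt_def b_neq0.
have := Q b c.
have -> : b ^+ 2 * a - 2 * b * c * c + c ^+ 2 * b = b * (a * b - c ^+ 2) by ring.
by rewrite pmulr_rge0// subr_ge0.
Qed.

(** This replaces the argument that u vanishes almost everywhere. *)
Lemma cubeint_mul_eq0 u v : continuous u -> continuous v ->
  cubeint (fun x => u x ^+ 2) = 0 -> cubeint (fun x => u x * v x) = 0.
Proof.
move=> cu cv u0; apply/eqP; rewrite -sqrf_eq0 eq_le sqr_ge0 andbT.
by rewrite (le_trans (cubeint_cauchy_schwarz cu cv))// u0 mul0r.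
Qed.

End cauchy_schwarz.

(** * The Dirichlet energy along the flow *)

Section joint_continuity.
Context {R : realType} {n : nat}.
Implicit Types (G H : 'rV[R]_n -> R -> R) (t : R).

Lemma jcontB t G H : jcont t G -> jcont t H -> jcont t (fun x s => G x s - H x s).
Proof. by move=> cG cH x; exact: (continuous_atB (cG x) (cH x)). Qed.

Lemma jcontM t G H : jcont t G -> jcont t H -> jcont t (fun x s => G x s * H x s).
Proof. by move=> cG cH x; exact: (continuous_atM (cG x) (cH x)). Qed.

Lemma jcontZ t (c : R) G : jcont t G -> jcont t (fun x s => c * G x s).
Proof. by move=> cG x; exact: (@continuous_atZ R _ c _ _ (cG x)). Qed.

Lemma jcont_comp t (h : R -> R) G : continuous h -> jcont t G ->
  jcont t (fun x s => h (G x s)).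
Proof.
by move=> ch cG x;
  exact: (@continuous_at_comp R _ h (fun p => G p.1 p.2) _ (ch _) (cG x)).
Qed.

Lemma jcont_fst t (g : 'rV[R]_n -> R) : continuous g -> jcont t (fun x _ => g x).
Proof.
move=> cg x; apply: (@continuous_comp _ _ _ (@fst 'rV[R]_n R) g); last exact: cg.
exact: cvg_fst.
Qed.

Lemma jcont_near t G H :
  (\forall s \near t, forall x, G x s = H x s) -> jcont t G -> jcont t H.
Proof.
move=> GH cG x; have GHt := nbhs_singleton GH.
rewrite /prop_for /continuous_at -[X in _ --> X]/(H x t) -GHt.
apply: cvg_trans (cG x); apply: near_eq_cvg.
have /= [r r0 rP] := GH.
exists (setT, ball t r) => /=; first by split; [exact: filterT|exact: nbhsx_ballx].
by move=> [y s] [_ /= sr]; rewrite (rP s).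
Qed.

End joint_continuity.

Section regularity.
Context {R : realType} {n : nat}.
Variables (phi : 'rV[R]_n -> R -> R).
Hypotheses (phi_C21 : C21 phi).
Implicit Types (s t : R).
Hypotheses (phi_per : forall t : R, 0 <= t -> Defs.periodic (slice phi t)).

Definition phi_t (x : 'rV[R]_n) (t : R) : R := derive1 (phi x) t.
Definition lap (x : 'rV[R]_n) (t : R) : R := laplacian (slice phi t) x.

(** The solution is continuous for t >= 0 only. Freezing it at its initial value
    for negative times gives a function continuous on the whole space-time, to
    which the two-sided statements apply at t = 0. *)
Lemma jcont_extension t : jcont t (fun x s => phi x (Num.max s 0)).
Proof.
move=> x; have [/subspace_continuousP c0 _ _ _ _] := phi_C21.
pose m (p : 'rV[R]_n * R) : 'rV[R]_n * R := (p.1, Num.max p.2 0).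
have m0 p : 0 <= (m p).2 by rewrite /= le_max lexx orbT.
have cm : {for (x, t), continuous m}.
  apply: continuous_at_pair; first exact: cvg_fst.
  have cmax : {for t, continuous (fun s : R => Num.max s 0)}.
    by apply: (@continuous_max R R id (cst 0) t); [exact: cvg_id|exact: cvg_cst].
  have csnd : {for (x, t), continuous (@snd 'rV[R]_n R)} by exact: cvg_snd.
  exact: (continuous_comp csnd cmax).
move=> B /(c0 _ (m0 (x, t))) NB.
apply: (@filterS _ (nbhs (x, t)) _ _ (fun p => B (phi p.1 (Num.max p.2 0))) _ (cm _ NB)).
by move=> p Bp; exact: Bp (m0 p).
Qed.

Lemma jcont_phi t : 0 < t -> jcont t phi.
Proof.
move=> t0; apply: (@jcont_near _ _ t _ phi _ (@jcont_extension t)).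
near=> s; move=> x; congr phi; apply/max_idPl; apply: ltW.
by near: s; exact: lt_nbhsr.
Unshelve. all: by end_near. Qed.

Lemma jcont_phi_t t : 0 < t -> jcont t phi_t.
Proof. by move=> t0 x; have [_ _ _ _ /(_ (x, t) t0)[]] := phi_C21. Qed.

Lemma jcont_lap t : 0 < t -> jcont t lap.
Proof.
move=> t0 x.
rewrite (_ : (fun p => lap p.1 p.2) = fun p : 'rV[R]_n * R =>
    \sum_i 'D_(e_ i) ('D_(e_ i) (slice phi p.2)) p.1); last first.
  by apply/funext => p; rewrite /lap laplacianE.
apply: continuous_at_sum => i.
by have [_ _ _ _ /(_ (x, t) t0)[_ _]] := phi_C21; apply.
Qed.

Lemma is_derive_phi x t : 0 < t -> is_derive (t : R) (1 : R) (phi x) (phi_t x t).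
Proof.
move=> t0; have [_ /(_ x t t0) dt _ _ _] := phi_C21.
by rewrite /phi_t derive1E; exact: derivableP.
Qed.

Lemma slice_C2 t : 0 < t -> periodic_C2 (slice phi t).
Proof.
move=> t0; have [_ _ dx dxx cxx] := phi_C21.
have pt := phi_per (ltW t0).
have jD i : jcont t (fun x s => 'D_(e_ i) (slice phi s) x).
  by move=> x; have [_ + _] := cxx (x, t) t0; apply.
have jDD i j : jcont t (fun x s => 'D_(e_ j) ('D_(e_ i) (slice phi s)) x).
  by move=> x; have [_ _ +] := cxx (x, t) t0; apply.
split; first split => //.
- exact: (jcont_slice (jcont_phi t0)).
- by move=> x i; exact: dx.
- by move=> i; exact: (jcont_slice (jD i)).
move=> i; split.
- exact: (jcont_slice (jD i)).
- exact: partial_periodic.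
- by move=> x j; exact: dxx.
- by move=> j; exact: (jcont_slice (jDD i j)).
Qed.

Lemma near_pos (t : R) (P : R -> Prop) : 0 < t -> (forall s, 0 < s -> P s) ->
  \forall s \near t, P s.
Proof.
move=> t0 sP; near=> s; apply: sP; near: s; exact: lt_nbhsr.
Unshelve. all: by end_near. Qed.

Lemma cubeint_continuous_pos (G : 'rV[R]_n -> R -> R) t : 0 < t ->
  (forall s, 0 < s -> jcont s G) -> {for t, continuous (fun s => cubeint (G^~ s))}.
Proof.
move=> t0 cG; apply: cubeint_continuous; first exact: cG.
by apply: (near_pos t0) => s s0; exact/jcont_slice/cG.
Qed.

Let squeeze3 (l r a b e : R) : `|l - a| <= e / 3 -> `|l - b| <= e / 3 ->
  `|r + a| <= `|b - a| -> `|- l - r| <= e.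
Proof.
move=> la lb rab.
have -> : - l - r = - ((l - a) + (r + a)) by ring.
rewrite normrN (le_trans (ler_normD _ _))//.
have := ler_distD l b a; rewrite (distrC b l); lra.
Qed.

(** Convexity, applied to the pairs of times (s, t) and (t, s), puts the
    difference quotient of the Dirichlet energy between - A s and - Q s, where A
    and Q pair the Laplacian at time t, respectively s, with the slope of phi. *)
Lemma is_derive_dirichlet t : 0 < t ->
  is_derive (t : R) (1 : R) (fun s => dirichlet (slice phi s))
    (- cubeint (fun x => lap x t * phi_t x t)).
Proof.
move=> t0.
pose S x s := slope_at phi phi_t t x s.
have cS : jcont t S.
  apply: jcont_slope; last exact: jcont_phi_t.
  by apply: (near_pos t0) => s s0 x; exact: is_derive_phi.
have cp (s : R) : 0 < s -> continuous (phi^~ s).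
  by move=> s0; exact: (jcont_slice (jcont_phi s0)).
have cSs (s : R) : 0 < s -> continuous (S^~ s).
  move=> s0; have [->|st] := eqVneq s t; first exact: jcont_slice.
  rewrite (_ : S^~ s = fun x => (phi x s - phi x t) / (s - t)); last first.
    by apply/funext => x; rewrite /S /slope_at (negPf st).
  move=> x; exact: (continuous_atM (continuous_atB (cp s s0 x) (cp t t0 x))
    (@continuous_at_cst R _ (s - t)^-1 x)).
have cl (s : R) : 0 < s -> continuous (lap^~ s).
  by move=> s0; exact: (jcont_slice (jcont_lap s0)).
pose l := cubeint (fun x => lap x t * phi_t x t).
pose A s := cubeint (fun x => lap x t * S x s).
pose Q s := cubeint (fun x => lap x s * S x s).
have SE x : S x t = phi_t x t by rewrite /S /slope_at eqxx.
have cA : A s @[s --> t] --> l.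
  have -> : l = A t by apply: eq_Rintegral => x _; rewrite SE.
  apply: (@cubeint_continuous _ _ t (fun x s => lap x t * S x s)).
    exact: (@jcontM R n t _ _ (@jcont_fst R n t _ (cl t t0)) cS).
  by apply: (near_pos t0) => s s0 x; exact: (continuous_atM (cl t t0 x) (cSs s s0 x)).
have cQ : Q s @[s --> t] --> l.
  have -> : l = Q t by apply: eq_Rintegral => x _; rewrite SE.
  apply: (@cubeint_continuous _ _ t (fun x s => lap x s * S x s)).
    exact: (@jcontM R n t _ _ (@jcont_lap t t0) cS).
  by apply: (near_pos t0) => s s0 x; exact: (continuous_atM (cl s s0 x) (cSs s s0 x)).
(* For s > t convexity bounds the quotient below by - A s and above by - Q s;
   for s < t the two bounds are exchanged. *)
have bound (s : R) : 0 < s -> s != t ->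
    `|(dirichlet (slice phi s) - dirichlet (slice phi t)) / (s - t) + A s| <= `|Q s - A s|.
  move=> s0 st.
  have [c2s c2t] := (slice_C2 s0, slice_C2 t0).
  have := dirichlet_convex c2s c2t.1.
  have := dirichlet_convex c2t c2s.1.
  have scaleE (g : 'rV[R]_n -> R) : continuous g ->
      cubeint (fun x => g x * (slice phi s x - slice phi t x)) =
      (s - t) * cubeint (fun x => g x * S x s).
    move=> cg; rewrite -cubeintZ; last first.
      by move=> x; exact: (continuous_atM (cg x) (cSs s s0 x)).
    apply: eq_Rintegral => x _; rewrite /S /slope_at (negPf st) /slice.
    by field; rewrite subr_eq0.
  rewrite (scaleE _ (cl s s0)) -/(Q s).
  have -> : cubeint (fun x => laplacian (slice phi t) x * (slice phi t x - slice phi s x)) =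
      - ((s - t) * A s).
    rewrite -(scaleE _ (cl t t0)) -mulN1r -cubeintZ; last first.
      move=> x; apply: (continuous_atM (cl t t0 x)).
      exact: (continuous_atB (cp s s0 x) (cp t t0 x)).
    by apply: eq_Rintegral => x _; rewrite mulN1r -mulrN opprB.
  rewrite opprK; move: (dirichlet (slice phi s)) (dirichlet (slice phi t)) => ds dt.
  move=> le1 le2; pose D := ds - dt; rewrite -[ds - dt]/D.
  have {}le1 : - ((s - t) * A s) <= D by rewrite lerNl /D opprB.
  have {}le2 : D <= - ((s - t) * Q s) by exact: le2.
  move: D le1 le2 => D le1 le2.
  have [E2 E1] : (s - t) * (D / (s - t) + A s) <= (s - t) * (A s - Q s) /\
           0 <= (s - t) * (D / (s - t) + A s).
    have -> : (s - t) * (D / (s - t) + A s) = D + (s - t) * A s.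
      by field; rewrite subr_eq0.
    by split; lra.
  move: st; rewrite neq_lt => /orP[]; rewrite -subr_lt0 // => h; last first.
    have {}h : 0 < s - t by lra.
    move: E1 E2; rewrite pmulr_rge0// ler_pM2l// => E1 E2.
    by rewrite ger0_norm// distrC (le_trans E2)// ler_norm.
  move: E1 E2; rewrite nmulr_rge0// ler_nM2l// => E1 E2.
  by rewrite ler0_norm// (le_trans _ (ler_norm _))//; lra.
rewrite -/l; clearbody A Q l.
have cvg : (fun h => h^-1 *: (((fun s => dirichlet (slice phi s)) \o shift t) (h *: 1) -
    dirichlet (slice phi t))) @ 0^' --> - l.
  have shift_t := @cvg_shift_dnbhs R t.
  apply/cvgrPdist_le => e e0.
  have e3 : 0 < e / 3 by rewrite divr_gt0.
  move: cA cQ => /cvgrPdist_le/(_ _ e3) nA /cvgrPdist_le/(_ _ e3) nQ.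
  have nP : \forall h \near 0^', 0 < h + t by exact: (shift_t _ (lt_nbhsr t0)).
  have {}nA : \forall h \near 0^', `|l - A (h + t)| <= e / 3 by exact: (shift_t _ nA).
  have {}nQ : \forall h \near 0^', `|l - Q (h + t)| <= e / 3 by exact: (shift_t _ nQ).
  near=> h.
  have h0 : h != 0 by near: h; exact: nbhs_dnbhs_neq.
  have ht0 : 0 < h + t by near: h.
  have hA : `|l - A (h + t)| <= e / 3 by near: h.
  have hQ : `|l - Q (h + t)| <= e / 3 by near: h.
  have := bound (h + t) ht0; rewrite -subr_eq0 addrK => /(_ h0).
  rewrite /= -[h *: 1]/(h * 1) mulr1 -[_ *: _]/(_ * _) [h^-1 * _]mulrC.
  exact: squeeze3.
by apply: DeriveDef; [apply/cvg_ex; eexists; exact: cvg|exact: cvg_lim cvg].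
Unshelve. all: by end_near. Qed.

End regularity.

(** * Calculus on the half-line and Gronwall's inequality *)

Section half_line.
Context {R : realType}.
Local Notation mu := (@lebesgue_measure R).
Implicit Types (g F : R -> R) (s t : R).

Lemma half_line_continuous_within g s t : 0 < s ->
  (forall r : R, 0 < r -> {for r, continuous g}) -> {within `[s, t], continuous g}.
Proof.
move=> s0 cg; apply: continuous_in_subspaceT => r /set_mem/=.
by rewrite in_itv/= => /andP[sr _]; apply: cg; exact: lt_le_trans sr.
Qed.

Lemma half_line_integrable g s t : 0 < s ->
  (forall r : R, 0 < r -> {for r, continuous g}) -> mu.-integrable `[s, t] (EFin \o g).
Proof.
move=> s0 cg; apply: continuous_compact_integrable; first exact: segment_compact.
exact: half_line_continuous_within.
Qed.

Lemma half_line_FTC2 g F s t : 0 < s -> s < t ->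
  (forall r : R, 0 < r -> {for r, continuous g}) ->
  (forall r : R, 0 < r -> is_derive r (1 : R) F (g r)) ->
  (\int[mu]_(r in `[s, t]) (g r)%:E = (F t - F s)%:E)%E.
Proof.
move=> s0 st cg dF.
have cF (r : R) : 0 < r -> {for r, continuous F}.
  move=> r0; apply/differentiable_continuous/derivable1_diffP.
  by have [] := dF r r0.
rewrite (continuous_FTC2 st (half_line_continuous_within s0 cg) (F := F)) ?EFinB//.
- split.
  + move=> r; rewrite in_itv/= => /andP[sr _].
    by have [] := dF r (lt_trans s0 sr).
  + by apply: cvg_at_right_filter; exact: cF.
  + by apply: cvg_at_left_filter; apply: cF; exact: lt_trans st.
- move=> r; rewrite in_itv/= => /andP[sr _].
  by rewrite derive1E; have [_ ->] := dF r (lt_trans s0 sr).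
Qed.

Lemma half_line_derive_le0 F (F' : R -> R) s t : 0 < s -> s <= t ->
  (forall r : R, s <= r <= t -> is_derive r (1 : R) F (F' r)) ->
  (forall r : R, s <= r <= t -> F' r <= 0) -> F t <= F s.
Proof.
move=> s0 st dF F'0; have [||c] := @MVT_segment R F F' s t st.
- move=> r; rewrite in_itv/= => /andP[/ltW sr /ltW rt]; apply: dF.
  by rewrite sr rt.
- apply: derivable_within_continuous => r; rewrite in_itv/= => /dF.
  by case.
rewrite in_itv/= => /F'0 c0 E.
by rewrite -subr_le0 E mulr_le0_ge0// subr_ge0.
Qed.

(** H may be singular at 0 as long as its integrals stay bounded: the usual
    inequality on [s, t] gives y t <= y s * expR (k * C), and y s tends to 0. *)
Lemma gronwall_from_0 (y y' H : R -> R) (k C d : R) : 0 <= k ->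
  (forall r : R, 0 < r -> {for r, continuous H}) -> (forall r : R, 0 <= H r) ->
  (forall s t : R, 0 < s -> s < t -> t < d -> \int[mu]_(r in `[s, t]) H r <= C) ->
  (forall r : R, 0 <= y r) ->
  (forall r : R, 0 < r -> is_derive r (1 : R) y (y' r)) ->
  (forall r : R, 0 < r -> r < d -> y' r <= k * H r * y r) ->
  (forall e : R, 0 < e -> exists2 s0, 0 < s0 & forall s : R, 0 < s < s0 -> y s < e) ->
  forall t : R, 0 < t -> t < d -> y t <= 0.
Proof.
move=> k0 cH H0 HC y0 dy yH ylim t t0 td.
have claim (s : R) : 0 < s -> s < t -> y t <= y s * expR (k * C).
  move=> s0 st.
  (* Starting the primitive at s / 2 makes it differentiable on all of [s, t]. *)
  pose G r := \int[mu]_(u in `[s / 2, r]) H u.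
  have s20 : 0 < s / 2 by rewrite divr_gt0.
  have s2s : s / 2 < s by lra.
  have G0 r : 0 <= G r by apply: Rintegral_ge0.
  have dG (r : R) : s <= r <= t -> is_derive r (1 : R) G (H r).
    move=> /andP[sr rt].
    have rr1 : r < r + 1 by rewrite ltrDl.
    have [dGr GE] := continuous_FTC1_closed rr1 (half_line_integrable (r + 1) s20 cH)
      (lt_le_trans s2s sr) (cH r (lt_le_trans s0 sr)).
    by apply: DeriveDef; [exact: dGr|rewrite -derive1E].
  have GC : G t <= C by exact: HC s20 (lt_trans s2s st) td.
  clearbody G.
  have dexp (r : R) : s <= r <= t -> is_derive r (1 : R) (fun u => expR (- k * G u))
      (expR (- k * G r) * (- k * H r)).
    move=> rst; have dGr := dG r rst.
    have dk : is_derive r (1 : R) (fun u => - k * G u) (- k * H r).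
      exact: (@is_deriveZ _ _ _ G (- k) r 1 (H r) dGr).
    have := @is_derive1_comp R (@expR R) (fun u => - k * G u) r _ _ (is_derive_expR _) dk.
    by [].
  have dz (r : R) : s <= r <= t -> is_derive r (1 : R) (fun u => y u * expR (- k * G u))
      (y r * (expR (- k * G r) * (- k * H r)) + expR (- k * G r) * y' r).
    move=> rst; have r0 : 0 < r by case/andP: rst => sr _; exact: lt_le_trans sr.
    exact: (is_deriveM (dy r r0) (dexp r rst)).
  have zts : y t * expR (- k * G t) <= y s * expR (- k * G s).
    apply: (half_line_derive_le0 s0 (ltW st) dz) => r /andP[sr rt].
    have r0 : 0 < r by exact: lt_le_trans sr.
    have := yH r r0 (le_lt_trans rt td) => yr.
    rewrite (_ : _ + _ = expR (- k * G r) * (y' r - k * H r * y r)); last by ring.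
    by rewrite pmulr_rle0 ?expR_gt0// subr_le0.
  have zs : y s * expR (- k * G s) <= y s.
    by rewrite ler_piMr// -expR0 ler_expR mulNr oppr_le0 mulr_ge0.
  have /= zE : y t = y t * expR (- k * G t) * expR (k * G t).
    by rewrite -mulrA -expRD mulNr addNr expR0 mulr1.
  rewrite zE; apply: (@le_trans _ _ (y s * expR (k * G t))).
    by rewrite ler_pM2r ?expR_gt0//; exact: le_trans zts zs.
  by apply: ler_wpM2l => //; rewrite ler_expR; exact: ler_wpM2l.
rewrite leNgt; apply/negP => yt0.
have [|s0 s00 ys0] := ylim (y t / expR (k * C)); first by rewrite divr_gt0// expR_gt0.
pose s := Num.min s0 t / 2.
have m0 : 0 < Num.min s0 t by rewrite lt_min s00.
have [ms mt] : Num.min s0 t <= s0 /\ Num.min s0 t <= t.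
  by rewrite !ge_min !lexx orbT.
have s_gt0 : 0 < s by rewrite divr_gt0.
have st : s < t by rewrite /s; lra.
have ss0 : s < s0 by rewrite /s; lra.
have := claim s s_gt0 st.
have := ys0 s; rewrite s_gt0 ss0 => /(_ isT); rewrite ltr_pdivlMr ?expR_gt0//.
by move=> h1 h2; have := lt_le_trans h1 h2; rewrite ltxx.
Qed.

(** For a nonnegative function the inverse, with value 0 at 0, is a real power,
    so that zeros of g are harmless. *)
Lemma inv_measurable (g : R -> R) (D : set R) : (forall t, 0 <= g t) ->
  measurable_fun D (g : measurableTypeR R -> R) ->
  measurable_fun D ((fun t => (g t)^-1) : measurableTypeR R -> R).
Proof.
move=> g0 mg; rewrite (_ : (fun t => _) = (fun x => x `^ (-1)) \o g).
  by apply: measurableT_comp => //; exact: measurable_powR.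
by apply/funext => t; rewrite /= powR_inv1.
Qed.

End half_line.

(** * Energy identities for the flow *)

Section flow.
Context {R : realType} {n : nat}.
Local Notation mu := (@lebesgue_measure R).
Variables (eps : R) (phi : 'rV[R]_n -> R -> R).
(** The function F of the overview, which is minus the first variation of the
    energy. *)
Definition chem (x : 'rV[R]_n) (t : R) : R :=
  eps * lap phi x t - derive1 W (phi x t) / eps.

Hypothesis eps0 : 0 < eps.
Hypothesis phi_C21 : C21 phi.
Hypothesis phi_per : forall t : R, 0 <= t -> Defs.periodic (slice phi t).
Hypothesis phi_eq : forall (x : 'rV[R]_n) (t : R), 0 < t ->
  eps * phi_t phi x t = chem x t + lambda eps phi t * sqrt2W (phi x t).

Implicit Types (s t : R).
Local Notation lam := (lambda eps phi).

Definition well (t : R) : R := cubeint (fun x => W (phi x t)).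
Definition energy (t : R) : R := eps * dirichlet (slice phi t) + well t / eps.
Definition chem_sqr (t : R) : R := cubeint (fun x => chem x t ^+ 2) / eps.
Definition dissipation (t : R) : R := cubeint (fun x => chem x t * phi_t phi x t).

Lemma jcont_chem t : 0 < t -> jcont t chem.
Proof.
move=> t0; apply: jcontB; first by apply: jcontZ; exact: jcont_lap.
move=> x; apply: (@continuous_atM _ _ (fun p : 'rV[R]_n * R => derive1 W (phi p.1 p.2))).
  by apply: (jcont_comp (@derive1_W_continuous R)); exact: jcont_phi.
exact: continuous_at_cst.
Qed.

Lemma jcont_sqr t G : @jcont R n t G -> jcont t (fun x s => G x s ^+ 2).
Proof. by move=> cG x; exact: (@continuous_atX R _ _ 2 _ (cG x)). Qed.

Lemma chem_sqr_continuous t : 0 < t -> {for t, continuous chem_sqr}.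
Proof.
move=> t0; apply: continuous_atM; last exact: continuous_at_cst.
apply: (@cubeint_continuous_pos _ _ (fun x s => chem x s ^+ 2)) => // s s0.
by apply: jcont_sqr; exact: jcont_chem.
Qed.

Lemma dissipation_continuous t : 0 < t -> {for t, continuous dissipation}.
Proof.
move=> t0.
apply: (@cubeint_continuous_pos _ _ (fun x s => chem x s * phi_t phi x s)) => // s s0.
by apply: jcontM; [exact: jcont_chem|exact: jcont_phi_t].
Qed.

Lemma well_ge0 t : 0 <= well t.
Proof. by apply: cubeint_ge0 => x; exact: W_ge0. Qed.

Lemma slice_facts t : 0 < t ->
  [/\ continuous (chem^~ t), continuous ((phi_t phi)^~ t), continuous (phi^~ t),
      continuous (fun x => sqrt2W (phi x t)) & continuous (fun x => W (phi x t))].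
Proof.
move=> t0.
have cp : continuous (phi^~ t).
  by exact: (jcont_slice (@jcont_phi _ _ _ phi_C21 _ t0)).
split=> //.
- exact: (jcont_slice (@jcont_chem _ t0)).
- exact: (jcont_slice (@jcont_phi_t _ _ _ phi_C21 _ t0)).
- by move=> x; exact: (continuous_comp (cp x) (@sqrt2W_continuous R (phi x t))).
- by move=> x; exact: (continuous_comp (cp x) (@W_continuous R (phi x t))).
Qed.

(** The definition of lambda, cleared of its denominator. When the denominator
    vanishes, sqrt (2W) has zero norm in L^2 and both sides are 0. *)
Lemma lambdaP t : 0 < t ->
  cubeint (fun x => chem x t * sqrt2W (phi x t)) = - (2 * lam t * well t).
Proof.
move=> t0; have [cc cpt cp cs cW] := slice_facts t0.
have lamE : lam t = - cubeint (fun x => chem x t * sqrt2W (phi x t)) / (2 * well t).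
  rewrite /lambda /lambda_of; congr (- _ / _).
  by apply: eq_Rintegral => x _; rewrite mulrC.
have [w0|w0] := eqVneq (well t) 0; last by rewrite lamE; field.
rewrite w0 mulr0 oppr0.
under [LHS]eq_Rintegral do rewrite mulrC.
apply: (cubeint_mul_eq0 cs cc).
under [LHS]eq_Rintegral do rewrite sqrt2W_sqr.
by rewrite [LHS](cubeintZ 2 cW) -/(well t) w0 mulr0.
Qed.

(** Multiply the equation by F and integrate; lambdaP evaluates the term with
    the multiplier. *)
Lemma dissipationE t : 0 < t ->
  dissipation t = chem_sqr t - 2 * lam t ^+ 2 * (well t / eps).
Proof.
move=> t0; have [cc cpt cp cs cW] := slice_facts t0.
have e0 : eps != 0 by rewrite gt_eqF.
apply: (mulfI e0); rewrite -cubeintZ; last first.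
  by move=> x; exact: (continuous_atM (cc x) (cpt x)).
have c2 : continuous (fun x => chem x t ^+ 2).
  by move=> x; exact: (@continuous_atX R _ _ 2 _ (cc x)).
have c3 : continuous (fun x => chem x t * sqrt2W (phi x t)).
  by move=> x; exact: (continuous_atM (cc x) (cs x)).
transitivity (cubeint (fun x => chem x t ^+ 2 + lam t * (chem x t * sqrt2W (phi x t)))).
  apply: eq_Rintegral => x _.
  by rewrite mulrCA (phi_eq x t0); ring.
rewrite cubeintD//; last by move=> x; exact: (@continuous_atZ R _ _ _ _ (c3 x)).
by rewrite cubeintZ// (lambdaP t0) /chem_sqr; field.
Qed.

(** Since sqrt (2W) phi_t has integral 0, replacing F by eps phi_t does not
    change the integral of F phi_t. *)
Lemma dissipation_ge0 t : 0 < t -> 0 <= dissipation t.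
Proof.
move=> t0; have [cc cpt cp cs cW] := slice_facts t0.
have e0 : eps != 0 by rewrite gt_eqF.
have c1 : continuous (fun x => phi_t phi x t ^+ 2).
  by move=> x; exact: (@continuous_atX R _ _ 2 _ (cpt x)).
have c3 : continuous (fun x => chem x t * phi_t phi x t).
  by move=> x; exact: (continuous_atM (cc x) (cpt x)).
have cv : continuous (fun x => sqrt2W (phi x t) * phi_t phi x t).
  by move=> x; exact: (continuous_atM (cs x) (cpt x)).
(* The multiplier is chosen so that the volume is preserved. *)
have volume : cubeint (fun x => sqrt2W (phi x t) * phi_t phi x t) = 0.
  apply: (mulfI e0); rewrite mulr0 -cubeintZ//.
  have c4 : continuous (fun x => chem x t * sqrt2W (phi x t)).
    by move=> x; exact: (continuous_atM (cc x) (cs x)).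
  transitivity (cubeint (fun x => chem x t * sqrt2W (phi x t)
                                  + (2 * lam t) * W (phi x t))).
    apply: eq_Rintegral => x _.
    rewrite mulrCA (phi_eq x t0).
    rewrite mulrDr mulrCA -expr2 sqrt2W_sqr; ring.
  rewrite cubeintD//; last by move=> x; exact: (@continuous_atZ R _ _ _ _ (cW x)).
  by rewrite cubeintZ// (lambdaP t0) addNr.
rewrite (_ : dissipation t = eps * cubeint (fun x => phi_t phi x t ^+ 2)).
  by rewrite mulr_ge0 ?(ltW eps0)//; apply: cubeint_ge0 => x; exact: sqr_ge0.
rewrite -[RHS]subr0 -(mulr0 (lam t)) -volume -!cubeintZ// -cubeintB.
- apply: eq_Rintegral => x _.
  rewrite expr2 mulrA (phi_eq x t0); ring.
- by move=> x; exact: (@continuous_atZ R _ _ _ _ (c1 x)).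
- by move=> x; exact: (@continuous_atZ R _ _ _ _ (cv x)).
Qed.

Lemma is_derive_well t : 0 < t -> is_derive (t : R) (1 : R) well
  (cubeint (fun x => derive1 W (phi x t) * phi_t phi x t)).
Proof.
move=> t0.
have dW : \forall s \near t, forall x,
    is_derive (s : R) (1 : R) (fun r => W (phi x r)) (derive1 W (phi x s) * phi_t phi x s).
  apply: (near_pos t0) => s s0 x.
  have dphi := is_derive_phi phi_C21 x s0.
  have dW := is_derive_W (phi x s); rewrite -derive1_W in dW.
  exact: (@is_derive1_comp R (@W R) (phi x) s _ _ dW dphi).
have jW' : jcont t (fun x s => derive1 W (phi x s) * phi_t phi x s).
  apply: jcontM; last exact: jcont_phi_t.
  by apply: (jcont_comp (@derive1_W_continuous R)); exact: jcont_phi.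
have cW : \forall s \near t, continuous (fun x => W (phi x s)).
  by apply: (near_pos t0) => s s0; have [] := slice_facts s0.
exact: (cubeint_derive dW jW' cW).
Qed.

Lemma is_derive_energy t : 0 < t ->
  is_derive (t : R) (1 : R) energy (- dissipation t).
Proof.
move=> t0; have [cc cpt cp cs cW] := slice_facts t0.
have dP := is_derive_dirichlet phi_C21 phi_per t0.
have dw := is_derive_well t0.
have dE := is_deriveD (@is_deriveZ _ _ _ _ eps t 1 _ dP)
  (@is_deriveZ _ _ _ _ eps^-1 t 1 _ dw).
rewrite (_ : energy = eps \*: (fun s => dirichlet (slice phi s)) + eps^-1 \*: well);
  last first.
  by apply/funext => s; rewrite /energy [X in _ + X]mulrC.
apply: is_derive_eq.
have cl : continuous ((lap phi)^~ t).
  by exact: (jcont_slice (@jcont_lap _ _ _ phi_C21 _ t0)).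
have cl2 : continuous (fun x => lap phi x t * phi_t phi x t).
  by move=> x; exact: (continuous_atM (cl x) (cpt x)).
have cW2 : continuous (fun x => derive1 W (phi x t) * phi_t phi x t).
  move=> x; apply: (continuous_atM _ (cpt x)).
  exact: (continuous_comp (cp x) (@derive1_W_continuous R (phi x t))).
rewrite /GRing.scale/= mulrN -!cubeintZ// addrC -cubeintB; last 2 first.
- by move=> x; exact: (@continuous_atZ R _ _ _ _ (cW2 x)).
- by move=> x; exact: (@continuous_atZ R _ _ _ _ (cl2 x)).
rewrite -mulN1r -cubeintZ; last first.
  by move=> x; exact: (continuous_atM (cc x) (cpt x)).
by apply: eq_Rintegral => x _; rewrite /chem; ring.
Qed.

Lemma energy_nonincreasing s t : 0 < s -> s <= t -> energy t <= energy s.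
Proof.
move=> s0 st; apply: (half_line_derive_le0 s0 st (F' := fun r => - dissipation r)).
- by move=> r /andP[sr _]; apply: is_derive_energy; exact: lt_le_trans sr.
- by move=> r /andP[sr _]; rewrite oppr_le0 dissipation_ge0//; exact: lt_le_trans sr.
Qed.

Lemma well_le_energy t : well t / eps <= energy t.
Proof. by rewrite lerDr mulr_ge0 ?(ltW eps0)// dirichlet_ge0. Qed.

(** lambda is a quotient of functions continuous for t > 0; it need not be
    continuous, as the denominator may vanish. *)
Lemma lambda_measurable :
  measurable_fun (`]0, +oo[%classic : set (measurableTypeR R)) lam.
Proof.
have mpos (g : R -> R) : (forall t, 0 < t -> {for t, continuous g}) ->
    measurable_fun (`]0, +oo[%classic : set (measurableTypeR R)) g.
  move=> cg; apply: open_continuous_measurable_fun; first exact: interval_open.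
  by move=> t /set_mem/=; rewrite in_itv/= andbT => t0; exact: cg.
apply: measurable_funM.
  apply: mpos => t t0.
  have c : {for t, continuous (fun s => cubeint (fun x => sqrt2W (phi x s) * chem x s))}.
    apply: (@cubeint_continuous_pos _ _ (fun x s => sqrt2W (phi x s) * chem x s)) => // s s0.
    apply: jcontM; last exact: jcont_chem.
    by apply: (jcont_comp (@sqrt2W_continuous R)); exact: jcont_phi.
  exact: continuousN c.
apply: inv_measurable.
  by move=> t; rewrite mulr_ge0// well_ge0.
apply: mpos => t t0; apply: continuous_atZ.
apply: (@cubeint_continuous_pos _ _ (fun x s => W (phi x s))) => // s s0.
by apply: (jcont_comp (@W_continuous R)); exact: jcont_phi.
Qed.

(** * Behaviour at the initial time and integration in time *)

Lemma cubeint_extension_continuous (h : R -> R) : continuous h ->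
  continuous (fun t : R => cubeint (fun x => h (phi x (Num.max t 0)))).
Proof.
move=> ch t; apply: (@cubeint_continuous _ _ t (fun x s => h (phi x (Num.max s 0)))).
  exact: (jcont_comp ch (@jcont_extension _ _ _ phi_C21 t)).
near=> s; exact: (jcont_slice (jcont_comp ch (@jcont_extension _ _ _ phi_C21 s))).
Unshelve. all: by end_near. Qed.

Let maxr0 (t : R) : 0 <= t -> Num.max t 0 = t.
Proof. by move=> t0; apply/max_idPl. Qed.

Lemma cubeint_bounded01 (h : R -> R) : continuous h ->
  exists2 C, 0 <= C & forall t, 0 < t -> t <= 1 -> cubeint (fun x => h (phi x t)) <= C.
Proof.
move=> ch; have cg := cubeint_extension_continuous ch.
have [c c01 Hc] := @EVT_max R _ 0 1 ler01 (continuous_subspaceT cg).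
exists `|cubeint (fun x => h (phi x (Num.max c 0)))| => // t t0 t1.
rewrite (le_trans _ (ler_norm _))//.
have := Hc t; rewrite maxr0 ?(ltW t0)//; apply.
by rewrite in_itv/= ltW.
Qed.

(** The right-hand side of the heat equation solved by phi. *)
Definition source (x : 'rV[R]_n) (t : R) : R := phi_t phi x t - lap phi x t.
Definition source_sqr (t : R) : R := cubeint (fun x => source x t ^+ 2).

Lemma jcont_source t : 0 < t -> jcont t source.
Proof. by move=> t0; apply: jcontB; [exact: jcont_phi_t|exact: jcont_lap]. Qed.

Lemma source_sqr_continuous t : 0 < t -> {for t, continuous source_sqr}.
Proof.
move=> t0; apply: (@cubeint_continuous_pos _ _ (fun x s => source x s ^+ 2)) => // s s0.
by apply: jcont_sqr; exact: jcont_source.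
Qed.

Lemma source_sqr_ge0 t : 0 <= source_sqr t.
Proof. by apply: cubeint_ge0 => x; exact: sqr_ge0. Qed.

(** The source is (lambda sqrt (2W) - W' / eps) / eps, and the integrals of W
    and W'^2 along phi are bounded up to t = 0, where phi is continuous. *)
Lemma source_sqr_bound : exists2 K, 0 <= K &
  forall t, 0 < t -> t <= 1 -> source_sqr t <= K * (1 + lam t ^+ 2).
Proof.
have cW'2 : continuous (fun s : R => derive1 W s ^+ 2).
  by move=> s; exact: (@continuous_atX R _ _ 2 _ (@derive1_W_continuous R s)).
have [C1 C10 H1] := cubeint_bounded01 (@W_continuous R).
have [C2 C20 H2] := cubeint_bounded01 cW'2.
pose k1 := 4 / eps ^+ 2; pose k2 := 2 / eps ^+ 4.
have k10 : 0 <= k1 by rewrite divr_ge0// exprn_ge0// ltW.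
have k20 : 0 <= k2 by rewrite divr_ge0// exprn_ge0// ltW.
exists (k1 * C1 + k2 * C2); first by apply: addr_ge0; apply: mulr_ge0.
move=> t t0 t1; have [cc cpt cp cs cW] := slice_facts t0.
have cW'2t : continuous (fun x => derive1 W (phi x t) ^+ 2).
  by move=> x; exact: (continuous_comp (cp x) (cW'2 (phi x t))).
have cf2 : continuous (fun x => source x t ^+ 2).
  have cf : continuous (source^~ t) by exact: (jcont_slice (@jcont_source _ t0)).
  by move=> x; exact: (@continuous_atX R _ _ 2 _ (cf x)).
have cA : continuous (fun x => (k1 * lam t ^+ 2) * W (phi x t)).
  by move=> x; exact: (@continuous_atZ R _ _ _ _ (cW x)).
have cB : continuous (fun x => k2 * derive1 W (phi x t) ^+ 2).
  by move=> x; exact: (@continuous_atZ R _ _ _ _ (cW'2t x)).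
apply: (@le_trans _ _ (cubeint (fun x => (k1 * lam t ^+ 2) * W (phi x t)
    + k2 * derive1 W (phi x t) ^+ 2))).
  apply: cubeint_le => //.
    by move=> x; exact: (continuous_atD (cA x) (cB x)).
  move=> x.
  have e0 : eps != 0 by rewrite gt_eqF.
  have -> : source x t = (lam t * sqrt2W (phi x t) - derive1 W (phi x t) / eps) / eps.
    by apply: (mulfI e0); rewrite /source mulrBr (phi_eq x t0) /chem; field.
  set a := lam t * sqrt2W (phi x t); set b := derive1 W (phi x t).
  have -> : k1 * lam t ^+ 2 * W (phi x t) + k2 * b ^+ 2 =
      2 * (a ^+ 2 + (b / eps) ^+ 2) / eps ^+ 2.
    by rewrite /a [(lam t * _) ^+ 2]exprMn sqrt2W_sqr /k1 /k2; field.
  rewrite expr_div_n ler_wpM2r ?invr_ge0 ?exprn_ge0 ?(ltW eps0)//.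
  by have := sqr_ge0 (a + b / eps); nra.
rewrite cubeintD// !cubeintZ// -/(well t).
have {}H1 := H1 t t0 t1; have {}H2 := H2 t t0 t1.
have l0 := sqr_ge0 (lam t).
have w0 := well_ge0 t.
rewrite -/(well t) in H1.
have : k1 * lam t ^+ 2 * well t <= k1 * lam t ^+ 2 * C1.
  by apply: ler_wpM2l => //; exact: mulr_ge0.
have : k2 * cubeint (fun x => derive1 W (phi x t) ^+ 2) <= k2 * C2.
  by exact: ler_wpM2l.
have : 0 <= k1 * C1 by exact: mulr_ge0.
have : 0 <= k2 * C2 * lam t ^+ 2 by apply: mulr_ge0 => //; exact: mulr_ge0.
by move=> *; lra.
Qed.

Hypothesis phi0_C1 : periodic_C1 (slice phi 0).
Variables (T L : R).
Hypothesis T0 : 0 < T.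
Hypothesis lambda_L2 :
  (\int[mu]_(t in `]0%R, T[) (lam t ^+ 2)%:E <= L%:E)%E.

Lemma lambda_sqr_measurable s t : 0 < s ->
  measurable_fun (`[s, t]%classic : set (measurableTypeR R)) (fun t => (lam t ^+ 2)%:E).
Proof.
move=> s0; apply/measurable_EFinP; apply: measurable_funX.
apply: (measurable_funS _ _ lambda_measurable) => //.
by move=> r /=; rewrite !in_itv/= andbT => /andP[sr _]; exact: lt_le_trans sr.
Qed.

Lemma lambda_sqr_integral_le s t : 0 < s -> t < T ->
  (\int[mu]_(r in `[s, t]) (lam r ^+ 2)%:E <= L%:E)%E.
Proof.
move=> s0 tT; apply: le_trans lambda_L2; apply: ge0_subset_integral => //.
- apply/measurable_EFinP; apply: measurable_funX.
  apply: (measurable_funS _ _ lambda_measurable) => //.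
  by move=> r /=; rewrite !in_itv/= andbT => /andP[].
- by move=> r _; rewrite lee_fin sqr_ge0.
- move=> r /=; rewrite !in_itv/= => /andP[sr rt].
  by rewrite (lt_le_trans s0 sr) (le_lt_trans rt tT).
Qed.

Lemma source_sqr_integrable : exists C, forall s t, 0 < s -> s < t -> t < Num.min T 1 ->
  \int[mu]_(r in `[s, t]) source_sqr r <= C.
Proof.
have [K K0 HK] := source_sqr_bound.
exists (K * (1 + L)) => s t s0 st; rewrite lt_min => /andP[tT t1].
have int_s := half_line_integrable t s0 source_sqr_continuous.
rewrite -lee_fin /Rintegral fineK; last exact: integrable_fin_num.
have ml := @lambda_sqr_measurable s t s0.
have l0 r : (0 <= (lam r ^+ 2)%:E)%E by rewrite lee_fin sqr_ge0.
apply: (@le_trans _ _ (\int[mu]_(r in `[s, t]) (K%:E * (1 + (lam r ^+ 2)%:E)))%E).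
  apply: ge0_le_integral => //.
  - by move=> r _; rewrite lee_fin source_sqr_ge0.
  - by have /integrableP[] := int_s.
  - by apply: measurable_funeM; apply: emeasurable_funD.
  - move=> r /=; rewrite in_itv/= => /andP[sr rt].
    rewrite -EFinD -EFinM lee_fin HK//; first exact: lt_le_trans sr.
    by rewrite (le_trans rt)// ltW.
rewrite ge0_integralZl//; last 2 first.
- exact: emeasurable_funD.
- by move=> r _; rewrite adde_ge0.
rewrite EFinM lee_wpmul2l ?lee_fin// ge0_integralD// EFinD leeD//.
  rewrite integral_cst//= lebesgue_measure_itv/= lte_fin st -EFinB -EFinM lee_fin.
  by lra.
exact: lambda_sqr_integral_le.
Qed.

(** Young's inequality with the weight for which its constant term eta cancels
    the gap eta; it is the differential inequality used in the next lemma, with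
    p = int psi Lap phi, c = int psi f, h = int f^2 and a, b the Dirichlet energies
    at times 0 and t. *)
Let absorb (a b p c eta y h : R) : 0 < eta -> a + eta < b -> b - a <= - p ->
  c ^+ 2 <= 2 * y * h -> p + c <= (2 * eta)^-1 * h * y.
Proof.
move=> eta0 ab bap cyh.
have young : c <= eta + (4 * eta)^-1 * c ^+ 2.
  have -> : eta + (4 * eta)^-1 * c ^+ 2 = c + (4 * eta)^-1 * (c - 2 * eta) ^+ 2.
    by field; rewrite gt_eqF.
  by rewrite lerDl mulr_ge0// ?sqr_ge0// invr_ge0 mulr_ge0// ltW.
have : (4 * eta)^-1 * c ^+ 2 <= (4 * eta)^-1 * (2 * y * h).
  by rewrite ler_wpM2l// invr_ge0 mulr_ge0// ltW.
have -> : (4 * eta)^-1 * (2 * y * h) = (2 * eta)^-1 * h * y.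
  by field; rewrite gt_eqF.
lra.
Qed.

(** If the Dirichlet energy stayed above its initial value by eta, then
    y = int psi^2 / 2 would satisfy y' <= y (int f^2) / (2 eta) with y 0 = 0, so
    that psi would vanish; but then convexity bounds the Dirichlet energy by its
    initial value. *)
Lemma dirichlet_limit (eta del : R) : 0 < eta -> 0 < del ->
  exists2 t, 0 < t < del & dirichlet (slice phi t) <= dirichlet (slice phi 0) + eta.
Proof.
move=> eta0 del0; apply: contrapT => H.
have {}H t : 0 < t -> t < del -> dirichlet (slice phi 0) + eta < dirichlet (slice phi t).
  by move=> t0 td; rewrite ltNge; apply/negP => Ht; apply: H; exists t => //; rewrite t0.
have c0 : continuous (phi^~ 0) by have [] := phi0_C1.
pose psi x t := phi x t - phi x 0.
have jpsi t : 0 < t -> jcont t psi.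
  by move=> t0; apply: jcontB; [exact: jcont_phi|exact: jcont_fst].
have cpsi t : 0 < t -> continuous (psi^~ t).
  by move=> t0; exact: (jcont_slice (jpsi t t0)).
pose y t := cubeint (fun x => 2^-1 * psi x t ^+ 2).
pose y' t := cubeint (fun x => psi x t * phi_t phi x t).
have yE t : 0 < t -> cubeint (fun x => psi x t ^+ 2) = 2 * y t.
  move=> t0; rewrite /y cubeintZ; first by field.
  by move=> x; exact: (@continuous_atX R _ _ 2 _ (cpsi t t0 x)).
have y0 t : 0 <= y t by apply: cubeint_ge0 => x; rewrite mulr_ge0// sqr_ge0.
have dy t : 0 < t -> is_derive (t : R) (1 : R) y (y' t).
  move=> t0; apply: (@cubeint_derive _ _ t (fun x s => 2^-1 * psi x s ^+ 2)
     (fun x s => psi x s * phi_t phi x s)).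
  - apply: (near_pos t0) => s s0 x.
    have dphi := is_derive_phi phi_C21 x s0.
    have dpsi : is_derive (s : R) (1 : R) (psi x) (phi_t phi x s).
      have := is_deriveB dphi (is_derive_cst (phi x 0) s (1 : R)).
      by rewrite subr0.
    have := @is_deriveZ _ _ _ _ 2^-1 s 1 _ (@is_deriveX _ _ (psi x) 2 s 1 _ dpsi).
    have -> : 2^-1 *: ((2%:R * psi x s ^+ 2.-1) *: phi_t phi x s) =
       psi x s * phi_t phi x s by rewrite /GRing.scale/= expr1; field.
    by [].
  - by apply: jcontM; [exact: jpsi|exact: jcont_phi_t].
  - apply: (near_pos t0) => s s0 x.
    exact: (@continuous_atZ R _ _ _ _ (@continuous_atX R _ _ 2 _ (cpsi s s0 x))).
have conv t : 0 < t -> dirichlet (slice phi t) - dirichlet (slice phi 0) <=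
    - cubeint (fun x => psi x t * lap phi x t).
  move=> t0; have := dirichlet_convex (slice_C2 phi_C21 phi_per t0) phi0_C1.
  by under [X in _ <= - X -> _]eq_Rintegral do rewrite mulrC.
have cl t : 0 < t -> continuous ((lap phi)^~ t).
  by move=> t0; exact: (jcont_slice (@jcont_lap _ _ _ phi_C21 _ t0)).
have csrc t : 0 < t -> continuous (source^~ t).
  by move=> t0; exact: (jcont_slice (@jcont_source _ t0)).
pose d := Num.min del (Num.min T 1).
have d0 : 0 < d by rewrite !lt_min del0 T0 ltr01.
have ygrow t : 0 < t -> t < d -> y' t <= (2 * eta)^-1 * source_sqr t * y t.
  move=> t0; rewrite lt_min => /andP[td _].
  have c1 : continuous (fun x => psi x t * lap phi x t).
    by move=> x; exact: (continuous_atM (cpsi t t0 x) (cl t t0 x)).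
  have c2 : continuous (fun x => psi x t * source x t).
    by move=> x; exact: (continuous_atM (cpsi t t0 x) (csrc t t0 x)).
  have -> : y' t = cubeint (fun x => psi x t * lap phi x t) +
                   cubeint (fun x => psi x t * source x t).
    by rewrite -cubeintD//; apply: eq_Rintegral => x _; rewrite /source; ring.
  have := cubeint_cauchy_schwarz (cpsi t t0) (csrc t t0).
  rewrite -/(source_sqr t) yE//.
  have := conv t t0; have := H t t0 td.
  set p := cubeint (fun x => psi x t * lap phi x t).
  set c := cubeint (fun x => psi x t * source x t).
  move=> h1 h2 cs.
  exact: (absorb eta0 h1 h2 cs).
have [C HC] := source_sqr_integrable.
have k0 : 0 <= (2 * eta)^-1 by rewrite invr_ge0 mulr_ge0// ltW.
have {}HC s t : 0 < s -> s < t -> t < d -> \int[mu]_(r in `[s, t]) source_sqr r <= C.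
  by move=> s0 st td; apply: HC => //; move: td; rewrite lt_min => /andP[].
have ylim e : 0 < e -> exists2 s0, 0 < s0 & forall s, 0 < s < s0 -> y s < e.
  move=> e0.
  pose G x s := 2^-1 * (phi x (Num.max s 0) - phi x 0) ^+ 2.
  have jG s : jcont s G.
    apply: jcontZ; apply: jcont_sqr; apply: jcontB; first exact: jcont_extension.
    exact: jcont_fst.
  have cG : {for 0, continuous (fun s => cubeint (G^~ s))}.
    apply: cubeint_continuous; first exact: jG.
    near=> s; exact: jcont_slice.
  have GE s : 0 <= s -> cubeint (G^~ s) = y s.
    by move=> s0; apply: eq_Rintegral => x _; rewrite /G maxr0.
  have y00 : y 0 = 0.
    rewrite -[RHS](cubeint_cst (n := n)); apply: eq_Rintegral => x _.
    by rewrite /psi subrr expr0n mulr0.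
  move: cG => /cvgrPdist_lt/(_ _ e0)[/= r r0 Hr].
  exists r => // s /andP[s0 sr].
  have := Hr s; rewrite /= sub0r normrN gtr0_norm// => /(_ sr).
  rewrite (GE s (ltW s0)) (GE 0 (lexx 0)) y00 sub0r normrN;
    exact: le_lt_trans (ler_norm _).
have := gronwall_from_0 k0 source_sqr_continuous source_sqr_ge0 HC y0 dy ygrow ylim.
have d20 : 0 < d / 2 by rewrite divr_gt0.
have d2d : d / 2 < d by lra.
move=> /(_ _ d20 d2d) yd.
have yd0 : y (d / 2) = 0 by apply/eqP; rewrite eq_le yd y0.
have := conv _ d20.
rewrite (cubeint_mul_eq0 (cpsi _ d20) (cl _ d20)); last by rewrite yE// yd0 mulr0.
move: d2d; rewrite lt_min => /andP[d2del _].
have := H _ d20 d2del => h1; rewrite oppr0 subr_le0 => h2.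
by have := lt_le_trans h1 h2; rewrite ltNge lerDl (ltW eta0).
Unshelve. all: by end_near. Qed.

(** The energy is nonincreasing for t > 0, so it suffices to find arbitrarily
    small times at which it hardly exceeds its initial value. *)
Lemma energy_le_initial t : 0 < t -> energy t <= energy 0.
Proof.
move=> t0; apply/ler_addgt0Pr => e e0.
pose eta := e / (2 * eps).
have eta0 : 0 < eta by rewrite divr_gt0// mulr_gt0.
have e20 : 0 < e * eps / 2 by rewrite divr_gt0// mulr_gt0.
have /cvgrPdist_lt/(_ _ e20)[/= r r0 Hr] :=
  @cubeint_extension_continuous _ (@W_continuous R) 0.
have m0 : 0 < Num.min r t by rewrite lt_min r0.
have [s /andP[s0]] := dirichlet_limit eta0 m0; rewrite lt_min => /andP[sr st] Ps.
rewrite (le_trans (energy_nonincreasing s0 (ltW st)))//.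
have := Hr s; rewrite /= sub0r normrN gtr0_norm// => /(_ sr).
rewrite !maxr0 ?(ltW s0)// -/(well s) -/(well 0) => ws.
have {}ws : well s <= well 0 + e * eps / 2.
  by rewrite -lerBlDl (le_trans (ler_norm _))// distrC ltW.
have -> : energy 0 + e =
    eps * (dirichlet (slice phi 0) + eta) + (well 0 + e * eps / 2) / eps.
  by rewrite /energy /eta; field; rewrite gt_eqF.
by rewrite lerD// ?ler_wpM2l ?ler_wpM2r// ?invr_ge0 ltW.
Qed.

Lemma energy_ge0 t : 0 <= energy t.
Proof. by rewrite (le_trans _ (well_le_energy t))// divr_ge0 ?well_ge0// ltW. Qed.

Lemma chem_sqr_ge0 t : 0 <= chem_sqr t.
Proof. by rewrite divr_ge0 ?(ltW eps0)//; apply: cubeint_ge0 => x;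
  exact: sqr_ge0. Qed.

(** The squared norm of F, divided by eps, is the dissipation plus
    2 lambda^2 int W / eps. The former integrates to a decrease of the energy, and int W / eps is at most
    the initial energy. *)
Lemma chem_sqr_integral_segment s t : 0 < s -> s < t -> t < T ->
  (\int[mu]_(r in `[s, t]) (chem_sqr r)%:E <= (energy 0 * (1 + 2 * L))%:E)%E.
Proof.
move=> s0 st tT.
pose b r := chem_sqr r - dissipation r.
have cb r : 0 < r -> {for r, continuous b}.
  move=> r0;
    exact: (continuous_atB (@chem_sqr_continuous _ r0) (@dissipation_continuous _ r0)).
have bE r : 0 < r -> b r = 2 * lam r ^+ 2 * (well r / eps).
  by move=> r0; rewrite /b (dissipationE r0); ring.
have pos r : r \in `[s, t] -> 0 < r.
  by rewrite in_itv/= => /andP[sr _]; exact: lt_le_trans sr.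
have b0 r : 0 < r -> 0 <= b r.
  move=> r0; rewrite (bE _ r0) mulr_ge0 ?divr_ge0 ?well_ge0 ?(ltW eps0)//.
  by rewrite mulr_ge0 ?sqr_ge0.
have int_b := half_line_integrable t s0 cb.
have int_d := half_line_integrable t s0 dissipation_continuous.
have E00 := energy_ge0 0.
under eq_integral => r rst.
  rewrite (_ : chem_sqr r = dissipation r + b r); last by rewrite /b addrC subrK.
  rewrite EFinD; over.
rewrite ge0_integralD//; last 4 first.
- by move=> r /pos r0; rewrite lee_fin dissipation_ge0.
- by have /integrableP[] := int_d.
- by move=> r /pos r0; rewrite lee_fin b0.
- by have /integrableP[] := int_b.
have dE (r : R) : 0 < r -> is_derive r (1 : R) (fun r => - energy r) (dissipation r).
  by move=> r0; have := is_deriveN (is_derive_energy r0); rewrite opprK.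
rewrite (half_line_FTC2 s0 st dissipation_continuous dE).
rewrite [in leRHS]mulrDr [in leRHS]mulr1 [leRHS]EFinD leeD//.
  rewrite lee_fin opprK addrC lerBlDr (le_trans (energy_le_initial s0))// lerDl.
  exact: energy_ge0.
apply: (@le_trans _ _ (\int[mu]_(r in `[s, t]) ((2 * energy 0)%:E * (lam r ^+ 2)%:E))%E).
  apply: ge0_le_integral => //.
  - by move=> r /pos r0; rewrite lee_fin b0.
  - by have /integrableP[] := int_b.
  - by apply: measurable_funeM; exact: lambda_sqr_measurable.
  - move=> r /pos r0; rewrite -EFinM lee_fin bE// mulrAC.
    rewrite ler_wpM2r ?sqr_ge0// ler_wpM2l//.
    by rewrite (le_trans (well_le_energy r))// energy_le_initial.
rewrite ge0_integralZl//; last 3 first.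
- exact: lambda_sqr_measurable.
- by move=> r _; rewrite lee_fin sqr_ge0.
- by rewrite lee_fin mulr_ge0.
rewrite [in leRHS]mulrA [energy 0 * 2]mulrC [leRHS]EFinM lee_wpmul2l ?lee_fin ?mulr_ge0//.
exact: lambda_sqr_integral_le.
Qed.

Lemma chem_sqr_integral :
  (\int[mu]_(r in `]0%R, T[) (chem_sqr r)%:E <= (energy 0 * (1 + 2 * L))%:E)%E.
Proof.
(* The compact segments [a k, T - a k] exhaust ]0, T[; dividing by at least 3
   makes them nonempty. *)
pose a (k : nat) : R := T / k.+3%:R.
have a0 k : 0 < a k by rewrite divr_gt0.
have a_le k l : (k <= l)%N -> a l <= a k.
  by move=> kl; rewrite ler_pM2l// lef_pV2 ?posrE// ler_nat.
have aT k : a k < T - a k.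
  have : 3 * a k <= T.
    by rewrite /a mulrCA ger_pMr// ler_pdivrMr// mul1r (ler_nat R 3).
  by have := a0 k; lra.
pose F (k : nat) : set (measurableTypeR R) := `[a k, T - a k]%classic.
have FE : `]0, T[%classic = \bigcup_k F k.
  apply/seteqP; split => r /=; rewrite ?in_itv/=.
    move=> /andP[r0 rT].
    have m0 : 0 < Num.min r (T - r) / T.
      by rewrite divr_gt0// lt_min r0 subr_gt0.
    have [k] := ltr_add_invr m0; rewrite add0r => kP.
    exists k => //; rewrite /F/= in_itv/=.
    have ak : a k <= Num.min r (T - r).
      apply: (@le_trans _ _ (T / k.+1%:R)).
        by rewrite ler_pM2l// lef_pV2 ?posrE// ler_nat; exact: leqW (leqnSn _).
      by move: kP; rewrite ltr_pdivlMr// mulrC => /ltW.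
    move: ak; rewrite le_min => /andP[-> ak] /=; lra.
  by move=> [k _]; rewrite /F/= in_itv/= => /andP[h1 h2]; have := a0 k; lra.
have mc k : measurable_fun (F k) (fun r => (chem_sqr r)%:E).
  by have /integrableP[] := half_line_integrable (T - a k) (a0 k) chem_sqr_continuous.
have ndF : {homo F : k l / (k <= l)%N >-> (k <= l)%O}.
  move=> k l kl; apply/subsetPset => r; rewrite /F/= !in_itv/= => /andP[kr rk].
  by rewrite (le_trans (a_le _ _ kl))//= (le_trans rk)// lerD2l lerN2 a_le.
have mF k : measurable (F k) by exact: measurable_itv.
have F0 k r : F k r -> (0 <= (chem_sqr r)%:E)%E by rewrite lee_fin chem_sqr_ge0.
have := ge0_nondecreasing_set_cvg_integral (mu := mu) ndF mF mc F0.
rewrite -FE => lim; rewrite -(cvg_lim _ lim)//; apply: lime_le.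
  by apply/cvg_ex; eexists; exact: lim.
near=> k; apply: chem_sqr_integral_segment => //.
by rewrite ltrBlDr ltrDl.
Unshelve. all: by end_near. Qed.

End flow.

(** * The initial data and the estimate *)

Section initial_data.
Context {R : realType}.

(** The primitive s - s^3 / 3 of sqrt (2W) on [-1, 1] gives sigma = 4 / 3. *)
Lemma sigma_gt0 : 0 < @sigma R.
Proof.
pose F (s : R) : R := s - s ^+ 3 / 3.
have dF (s : R) : is_derive s (1 : R) F (1 - s ^+ 2).
  rewrite (_ : F = id - 3^-1 \*: (id ^+ 3)); last first.
    by apply/funext => x; rewrite /F mulrC.
  apply: is_derive_eq.
  by rewrite /GRing.scale/=; field.
have cF : continuous F.
  by move=> s; apply/differentiable_continuous/derivable1_diffP; have [] := dF s.
have lt11 : (-1 : R) < 1 by lra.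
have F' : {in `]-1, 1[, F^`()%classic =1 (@sqrt2W R)}.
  move=> s; rewrite in_itv/= => /andP[s1 s2].
  rewrite derive1E; have [_ ->] := dF s.
  rewrite /sqrt2W /W mulrCA divff ?mulr1// sqrtr_sqr ger0_norm//; nra.
have dFo : derivable_oo_LRcontinuous F (-1) 1.
  split.
  + by move=> s _; have [] := dF s.
  + by apply: cvg_at_right_filter; exact: cF.
  + by apply: cvg_at_left_filter; exact: cF.
rewrite /sigma /Rintegral.
rewrite (continuous_FTC2 lt11 (continuous_subspaceT (@sqrt2W_continuous R)) dFo F').
rewrite -EFinB/= /F; lra.
Qed.

Lemma is_derive_tanh (s : R) :
  is_derive s (1 : R) (@Defs.tanh R) (1 - Defs.tanh s ^+ 2).
Proof.
have dN : is_derive s (1 : R) (fun x : R => expR (- x)) (- expR (- s)).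
  have dopp : is_derive s (1 : R) (fun x : R => - x) (-1).
    exact: (is_deriveN (is_derive_id s (1 : R))).
  have := @is_derive1_comp R (@expR R) (fun x => - x) s _ _ (is_derive_expR _) dopp.
  by rewrite mulrN1.
have dE := is_derive_expR s.
have pos : 0 < expR s + expR (- s) by rewrite addr_gt0 ?expR_gt0.
pose N (x : R) : R := expR x - expR (- x); pose D (x : R) : R := expR x + expR (- x).
have dN' : is_derive s (1 : R) N (D s).
  by have := is_deriveB dE dN; rewrite opprK.
have dD : is_derive s (1 : R) D (N s) by exact: is_deriveD dE dN.
have D0 : D s != 0 by rewrite lt0r_neq0.
have := is_deriveM dN' (is_deriveV D0 dD).
rewrite (_ : N s *: _ + _ = 1 - Defs.tanh s ^+ 2); first by [].
rewrite /Defs.tanh -/(N s) -/(D s) /GRing.scale/=; field.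
exact: D0.
Qed.

Lemma periodic_C1_comp (n : nat) (h h' : R -> R) (u : 'rV[R]_n -> R) :
  (forall s : R, is_derive s (1 : R) h (h' s)) -> continuous h' ->
  periodic_C1 u -> periodic_C1 (fun x => h (u x)).
Proof.
move=> dh ch' [cu pu du cdu].
have ch : continuous h.
  by move=> s; apply/differentiable_continuous/derivable1_diffP; have [] := dh s.
have DE x i : is_derive x (e_ i) (fun x => h (u x)) (h' (u x) * 'D_(e_ i) u x).
  have l0 (g : 'rV[R]_n -> R) : (fun t : R => g (x + t *: e_ i)) 0 = g x.
    by rewrite scale0r addr0.
  have dl : is_derive (0 : R) (1 : R) (fun t => u (x + t *: e_ i)) ('D_(e_ i) u x).
    apply/is_derive_line; rewrite scale0r addr0; exact: derivableP.
  have := dh (u x); rewrite -{1}(l0 u) => dh0.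
  have := is_derive1_comp dh0 dl.
  by move=> /(is_derive_line (fun x => h (u x)) x (e_ i) 0); rewrite scale0r addr0.
split.
- by move=> x; exact: (continuous_comp (cu x) (ch (u x))).
- by move=> x i; rewrite pu.
- by move=> x i; have [] := DE x i.
- move=> i; rewrite (_ : 'D_(e_ i) _ = fun x => h' (u x) * 'D_(e_ i) u x).
    by move=> x;
      exact: (continuous_atM (continuous_comp (cu x) (ch' (u x))) (cdu i x)).
  by apply/funext => x; have [_ ->] := DE x i.
Qed.

Lemma initial_profile_C1 (n : nat) (eps : R) (rbar : 'rV[R]_n -> R) :
  Ck 3 rbar -> Defs.periodic rbar -> periodic_C1 (fun x => q eps (rbar x)).
Proof.
move=> [cr dr] pr.
apply: (@periodic_C1_comp n (q eps) (fun s => (1 - Defs.tanh (s / eps) ^+ 2) / eps)).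
- move=> s.
  have dd : is_derive s (1 : R) (fun x : R => x / eps) (eps^-1).
    rewrite (_ : (fun x : R => x / eps) = eps^-1 \*: id); last first.
      by apply/funext => x; rewrite mulrC.
    by apply: is_derive_eq; rewrite /GRing.scale/= mulr1.
  rewrite (_ : q eps = @Defs.tanh R \o (fun x : R => x / eps)); last by [].
  exact: (@is_derive1_comp R (@Defs.tanh R) (fun x : R => x / eps) s _ _
    (is_derive_tanh (s / eps)) dd).
- move=> s.
  have ct : continuous (@Defs.tanh R).
    move=> x; apply/differentiable_continuous/derivable1_diffP.
    by have [] := is_derive_tanh x.
  have c1 : {for s, continuous (fun x : R => x / eps)}.
    exact: (continuous_atM cvg_id (@continuous_at_cst R _ eps^-1 s)).
  have c2 : {for s, continuous (fun x : R => Defs.tanh (x / eps) ^+ 2)}.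
    exact: (@continuous_atX R _ _ 2 _ (continuous_comp c1 (ct (s / eps)))).
  exact: (continuous_atM (continuous_atB (@continuous_at_cst R _ 1 s) c2)
    (@continuous_at_cst R _ eps^-1 s)).
- split=> //.
  + by move=> x i; have [] := dr i.
  + by move=> i; have [_ []] := dr i.
Qed.

Lemma enorm_sqr (n : nat) (x : 'rV[R]_n) : enorm x ^+ 2 = \sum_i x ord0 i ^+ 2.
Proof. by rewrite /enorm sqr_sqrtr// sumr_ge0// => i _; exact: sqr_ge0. Qed.

Lemma initial_energy_le (n : nat) (eps D1 : R) (u : 'rV[R]_n -> R) : 0 < eps ->
  periodic_C1 u -> (Defs.mu eps u cube <= D1%:E)%E ->
  eps * dirichlet u + cubeint (fun x => W (u x)) / eps <= sigma * D1.
Proof.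
move=> eps0 [cu pu du cdu]; rewrite /Defs.mu.
have cW : continuous (fun x => W (u x)).
  by move=> x; exact: (continuous_comp (cu x) (@W_continuous R (u x))).
have cD i : continuous (fun x => 'D_(e_ i) u x ^+ 2).
  by move=> x; exact: (@continuous_atX R _ _ 2 _ (cdu i x)).
have cS : continuous (fun x => \sum_i 'D_(e_ i) u x ^+ 2).
  by move=> x; apply: continuous_at_sum => i; exact: cD.
have c1 : continuous (fun x => eps / 2 * \sum_i 'D_(e_ i) u x ^+ 2).
  by move=> x; exact: (@continuous_atZ R _ _ _ _ (cS x)).
have c2 : continuous (fun x => eps^-1 * W (u x)).
  by move=> x; exact: (@continuous_atZ R _ _ _ _ (cW x)).
have c12 : continuous (fun x => eps / 2 * (\sum_i 'D_(e_ i) u x ^+ 2) + eps^-1 * W (u x)).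
  by move=> x; exact: (continuous_atD (c1 x) (c2 x)).
under eq_integral => x _.
  rewrite (_ : eps * _ / 2 + _ =
    eps / 2 * (\sum_i 'D_(e_ i) u x ^+ 2) + eps^-1 * W (u x)); last first.
    rewrite enorm_sqr; congr (_ + _); last by rewrite mulrC.
    by rewrite mulrAC; congr (_ * _); apply: eq_bigr => i _; rewrite mxE.
  over.
rewrite (cubeint_EFin c12) -EFinM lee_fin ler_pdivrMl ?sigma_gt0//.
rewrite cubeintD// !cubeintZ// cubeint_sum// /dirichlet.
by rewrite mulrA [eps^-1 * _]mulrC.
Qed.

End initial_data.

Theorem proposition3p4 (R : realType) (d : nat) (d_ge2 : (2 <= d)%N)
    (c1 : R -> R -> R) (eps1 : R -> R)
    (c1_gt0 : forall omega D1 : R, 0 < omega -> 0 < D1 -> 0 < c1 omega D1)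
    (eps1_gt0 : forall omega : R, 0 < omega -> 0 < eps1 omega) :
  exists c4 : R -> R -> R,
    (forall omega D1 : R, 0 < omega -> 0 < D1 -> 0 < c4 omega D1) /\
    forall (omega D0 D1 : R) (U0 : set 'rV[R]_d) (U : nat -> set 'rV[R]_d)
        (eps : nat -> R) (rbar : nat -> 'rV[R]_d -> R)
        (phi : nat -> 'rV[R]_d -> R -> R),
      0 < omega -> 0 < D0 -> 0 < D1 ->
      initial_set D0 U0 U ->
      (forall i, 0 < eps i < 1) ->
      (forall i j, (i <= j)%N -> eps j <= eps i) ->
      eps @ \oo --> (0 : R) ->
      (forall i, smoothed_dist (eps i) (U i) (rbar i)) ->
      (forall i, is_solution (eps i) (fun x => q (eps i) (rbar i x)) (phi i)) ->
      (forall i, standing_bounds omega D1 (eps i)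
                   (fun x => q (eps i) (rbar i x))) ->
      (forall T : R, 0 < T -> forall i, eps i < eps1 omega ->
        (\int[lebesgue_measure]_(t in `]0%R, T[)
           (`| lambda (eps i) (phi i) t | ^+ 2)%:E
         <= (c1 omega D1 * (1 + T))%:E)%E) ->
      forall T : R, 0 < T -> forall i, eps i < eps1 omega ->
        (\int[lebesgue_measure]_(t in `]0%R, T[)
           \int[leb d]_(x in cube)
             (eps i * (laplacian (slice (phi i) t) x
                       - derive1 W (phi i x t) / eps i ^+ 2) ^+ 2)%:E
         <= (c4 omega D1 * (1 + T))%:E)%E.
Proof.
(* sigma D1 bounds the initial energy, and 1 + 2 c1 (1 + T) <= (1 + 2 c1) (1 + T). *)
exists (fun omega D1 => sigma * D1 * (1 + 2 * c1 omega D1)).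
have c1_factor omega D1 : 0 < omega -> 0 < D1 -> 1 <= 1 + 2 * c1 omega D1.
  by move=> om D10; rewrite lerDl mulr_ge0// ltW// c1_gt0.
split=> [omega D1 om D10|].
  by rewrite mulr_gt0 ?mulr_gt0 ?sigma_gt0// (lt_le_trans ltr01)// c1_factor.
move=> omega D0 D1 U0 U eps rbar phi om _ D10 _ eps01 _ _ smooth sol bounds.
move=> lamL2 T T0 i epsi.
have [eps0 _] := andP (eps01 i).
have [cr pr _ _ _] := smooth i.
have [C21phi per phi0 eqn] := sol i.
have [_ mu_le _] := bounds i.
have slice0 : slice (phi i) 0 = fun x => q (eps i) (rbar i x).
  by apply/funext => x; exact: phi0.
have u0C1 : periodic_C1 (slice (phi i) 0) by rewrite slice0;
  exact: initial_profile_C1.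
have L2 : (\int[lebesgue_measure]_(t in `]0%R, T[) (lambda (eps i) (phi i) t ^+ 2)%:E
    <= (c1 omega D1 * (1 + T))%:E)%E.
  apply: le_trans (lamL2 T T0 i epsi); rewrite le_eqVlt; apply/orP; left; apply/eqP.
  by apply: eq_integral => t _; rewrite real_normK// num_real.
have E0 : energy (eps i) (phi i) 0 <= sigma * D1.
  rewrite /energy; apply: (initial_energy_le eps0 u0C1).
  by rewrite slice0.
have main := chem_sqr_integral eps0 C21phi per eqn u0C1 T0 L2.
rewrite (_ : (\int[lebesgue_measure]_(t in `]0%R, T[) _)%E =
    (\int[lebesgue_measure]_(t in `]0%R, T[) (chem_sqr (eps i) (phi i) t)%:E)%E);
      last first.
  apply: eq_integral => t /set_mem; rewrite /= in_itv/= => /andP[t0 _].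
  have cc : continuous ((chem (eps i) (phi i))^~ t).
    exact: (jcont_slice (@jcont_chem _ _ (eps i) (phi i) C21phi t t0)).
  have cc2 : continuous (fun x => (eps i)^-1 * chem (eps i) (phi i) x t ^+ 2).
    by move=> x;
      exact: (@continuous_atZ R _ _ _ _ (@continuous_atX R _ _ 2 _ (cc x))).
  rewrite (_ : chem_sqr _ _ t =
      cubeint (fun x => (eps i)^-1 * chem (eps i) (phi i) x t ^+ 2)).
    rewrite -(cubeint_EFin cc2); apply: eq_integral => x _; congr EFin.
    by rewrite /chem /lap; field; rewrite gt_eqF.
  rewrite /chem_sqr cubeintZ; first by rewrite mulrC.
  by move=> x; exact: (@continuous_atX R _ _ 2 _ (cc x)).
apply: le_trans main _; rewrite lee_fin.
have c10 := c1_gt0 omega D1 om D10.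
apply: (@le_trans _ _ (sigma * D1 * (1 + 2 * (c1 omega D1 * (1 + T))))).
  rewrite ler_wpM2r// addr_ge0// !mulr_ge0// ?addr_ge0// ltW//.
rewrite -[leRHS]mulrA; apply: ler_wpM2l; first by rewrite mulr_ge0// ltW// sigma_gt0.
have -> : (1 + 2 * c1 omega D1) * (1 + T) = 1 + 2 * (c1 omega D1 * (1 + T)) + T by ring.
by rewrite lerDl ltW.
Qed.
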